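(* Let $\mathcal I$ be a tensor ideal of $\mathcal T$ satisfying the standing assumption in the context. Suppose that $$\dim_{\mathbb Q(q)}\left((\mathcal T/\mathcal I)(\mathsf I^{\otimes3},\mathsf I^{\otimes2})\right)\le15,$$ and that the ten morphisms $N_1,\dots,N_5,X_1,\dots,X_5$ are linearly independent in $(\mathcal T/\mathcal I)(\mathsf I^{\otimes2},\mathsf I^{\otimes3})$. Then in $\mathcal T/\mathcal I$ $$\mathsf P=-\sum_{j=1}^5Q_j-\frac{[7]}{[4]^2}\sum_{j=1}^5N_j+\frac{[3]^2}{[4]^2}\sum_{j=1}^5X_j.$$
   Context: $[n]=\frac{q^n-q^{-n}}{q-q^{-1}}$. **Monoidal notation.** $\mathbb 1$ is the unit object, morphisms compose right to left ($fg=f\circ g$), $1$ denotes the identity of the object $\mathsf I$, and $1_n$ the identity of $\mathsf I^{\otimes n}$. (String diagrams are read bottom to top; $m$ is a trivalent merge; $\sigma_+$ is the crossing in which the strand from bottom left to top right passes over, $\sigma_-$ the opposite crossing.) **The category $\mathcal T$.** Let $\Bbbk=\mathbb Q(q)$, $\tau=q^{12}$, $\beta=q^{24}$, $\delta=\frac{[3][8][13][18]}{[4][6][9]}$, $\phi=\frac{[2][7][12]}{[4][6]}$. $\mathcal T$ is the strict $\Bbbk$-linear monoidal category generated by one object $\mathsf I$ and morphisms $m:\mathsf I^{\otimes2}\to\mathsf I$, $\sigma_+,\sigma_-:\mathsf I^{\otimes 2}\to\mathsf I^{\otimes2}$, $\cup:\mathbb1\to\mathsf I^{\otimes2}$, $\cap:\mathsf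 I^{\otimes2}\to\mathbb1$, subject to: (R1) $(\cap\otimes1)(1\otimes\cup)=1=(1\otimes\cap)(\cup\otimes1)$; (R2) $(1\otimes m)(\cup\otimes1)=(m\otimes1)(1\otimes\cup)$; this common morphism $\mathsf I\to\mathsf I^{\otimes2}$ is denoted $s$; (R3) $(1\otimes\cap)(\sigma_-\otimes1)=(\cap\otimes1)(1\otimes\sigma_+)$ and $(1\otimes\cap)(\sigma_+\otimes1)=(\cap\otimes1)(1\otimes\sigma_-)$; (R4) $\sigma_-\sigma_+=1_2=\sigma_+\sigma_-$; (R5) $(\sigma_+\otimes1)(1\otimes\sigma_+)(\sigma_+\otimes1)=(1\otimes\sigma_+)(\sigma_+\otimes1)(1\otimes\sigma_+)$; (R6) $(1\otimes m)(\sigma_+\otimes1)(1\otimes\sigma_+)=\sigma_+(m\otimes1)$; (R7) $(1\otimes\sigma_+)(\sigma_+\otimes1)(1\otimes s)=(s\otimes1)\sigma_+$; (R8) $\cap\sigma_+=\beta\cap$, $m\sigma_+=\tau m$, $ms=\phi 1$, $\cap\cup=\delta1_{\mathbb1}$, $m\cup=0$. Put $\mathsf U=\cup\cap$, $\mathsf H=(m\otimes1)(1\otimes s)=(1\otimes m)(s\otimes1)$, $\mathsf N=sm$, and $\mathsf P=(1\otimes m\otimes1)(s\otimes s)\mathsf H$ (the pentagon). Also, as morphisms $\mathsf I^{\otimes2}\to\mathsf I^{\otimes3}$: $Q_1=(1\otimes m\otimes1)(s\otimes s)$, $Q_2=(s\otimes1)sm$, $Q_3=(1\otimes s)sm$,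 $Q_4=(1\otimes s)\mathsf H$, $Q_5=(s\otimes1)\mathsf H$; $N_1=(1\otimes s)\cup\cap$, $N_2=1\otimes s$, $N_3=s\otimes1$, $N_4=\cup\otimes m$, $N_5=m\otimes\cup$; $X_1=(1\otimes\sigma_+)(\cup\otimes m)$, $X_2=(1\otimes\sigma_-)(s\otimes1)$, $X_3=(\sigma_+\otimes1)(1\otimes s)$, $X_4=(s\otimes1)\sigma_+$, $X_5=(1\otimes s)\sigma_-$. **Standing assumption.** $\delta\notin\{q^4+q^{-4},\,-q^{16}-q^{-16}\}$, and $\mathcal I$ is a tensor ideal of $\mathcal T$ such that $1_2,\ \mathsf U,\ \mathsf H,\ \mathsf N,\ \sigma_++\sigma_-$ form a $\Bbbk$-basis of $(\mathcal T/\mathcal I)(\mathsf I^{\otimes2},\mathsf I^{\otimes2})$. The same symbols denote morphisms of $\mathcal T$ and their images in $\mathcal T/\mathcal I$. *)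

(* Defs.v *)
From HB Require Import structures.
From mathcomp Require Import all_boot all_order all_algebra.
From mathcomp Require Import generic_quotient ring_quotient boolp.

Set Implicit Arguments.
Unset Strict Implicit.
Unset Printing Implicit Defensive.

Import GRing.Theory.
Local Open Scope ring_scope.
Local Open Scope quotient_scope.

Definition Qq : fieldType := {fraction {poly rat}}.
Definition q : Qq := tofrac ('X : {poly rat}).
Definition qint (n : nat) : Qq := (q ^+ n - q ^- n) / (q - q^-1).

Definition tau : Qq := q ^+ 12.
Definition beta : Qq := q ^+ 24.
Definition delta : Qq :=
  (qint 3 * qint 8 * qint 13 * qint 18) / (qint 4 * qint 6 * qint 9).
Definition phi : Qq := (qint 2 * qint 7 * qint 12) / (qint 4 * qint 6).

(* Formal diagrams.  The objects of a strict monoidal category generated by one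
   object I are the tensor powers of I, so they are represented by natural
   numbers; [term m n] contains the expressions for morphisms from the m-th to
   the n-th tensor power; [tcomp f g] is f after g. *)
Inductive term : nat -> nat -> Type :=
| tid n : term n n
| tcomp m n p (f : term n p) (g : term m n) : term m p
| ttens m n m' n' (f : term m n) (g : term m' n') : term (m + m') (n + n')
| tzero m n : term m n
| tadd m n (f g : term m n) : term m n
| tscale m n (a : Qq) (f : term m n) : term m n
| tmerge : term 2 1
| tsigp : term 2 2
| tsigm : term 2 2
| tcup : term 0 2
| tcap : term 2 0.

Declare Scope term_scope.
Delimit Scope term_scope with T.
Bind Scope term_scope with term.
Arguments tzero {m n}.
Arguments tcomp {m n p} (f g)%_T.
Arguments ttens {m n m' n'} (f g)%_T.
Arguments tadd {m n} (f g)%_T.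
Arguments tscale {m n} a%_R f%_T.

Notation "f ∘ g" := (tcomp f g) (at level 39, left associativity) : term_scope.
Notation "f ⊗ g" := (ttens f g) (at level 38, left associativity) : term_scope.
Notation "f + g" := (tadd f g) : term_scope.
Notation "a *: f" := (tscale a f) : term_scope.

Definition tcast m n m' n' (em : m = m') (en : n = n') (f : term m n) :
    term m' n' :=
  ecast i (term i n') em (ecast j (term m j) en f).

Definition tsplit : term 1 2 := ((tid 1 ⊗ tmerge) ∘ (tcup ⊗ tid 1))%T.

(* The least congruence on formal diagrams containing the axioms of strict
   linear monoidal categories and the defining relations.  Strict associativity
   and unitality of the tensor product identify terms whose types are only
   provably equal, whence the casts. *)
Inductive teq : forall m n, term m n -> term m n -> Prop :=
| teq_refl m n (f : term m n) : teq f f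
| teq_sym m n (f g : term m n) : teq f g -> teq g f
| teq_trans m n (f g h : term m n) : teq f g -> teq g h -> teq f h
| teq_comp m n p (f f' : term n p) (g g' : term m n) :
    teq f f' -> teq g g' -> teq (f ∘ g) (f' ∘ g')
| teq_tens m n m' n' (f f' : term m n) (g g' : term m' n') :
    teq f f' -> teq g g' -> teq (f ⊗ g) (f' ⊗ g')
| teq_add m n (f f' g g' : term m n) :
    teq f f' -> teq g g' -> teq (f + g) (f' + g')
| teq_scale m n a (f f' : term m n) : teq f f' -> teq (a *: f) (a *: f')
| teq_addA m n (f g h : term m n) : teq (f + (g + h)) (f + g + h)
| teq_addC m n (f g : term m n) : teq (f + g) (g + f)
| teq_add0 m n (f : term m n) : teq (tzero + f) f
| teq_scale0 m n (f : term m n) : teq (0%R *: f) tzero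
| teq_scale1 m n (f : term m n) : teq (1%R *: f) f
| teq_scaleA m n a b (f : term m n) : teq (a *: (b *: f)) ((a * b)%R *: f)
| teq_scaleDr m n a (f g : term m n) : teq (a *: (f + g)) (a *: f + a *: g)
| teq_scaleDl m n a b (f : term m n) : teq ((a + b)%R *: f) (a *: f + b *: f)
| teq_compA m n p r (f : term p r) (g : term n p) (h : term m n) :
    teq (f ∘ (g ∘ h)) (f ∘ g ∘ h)
| teq_comp1l m n (f : term m n) : teq (tid n ∘ f) f
| teq_comp1r m n (f : term m n) : teq (f ∘ tid m) f
| teq_compDl m n p (f f' : term n p) (g : term m n) :
    teq ((f + f') ∘ g) (f ∘ g + f' ∘ g)
| teq_compDr m n p (f : term n p) (g g' : term m n) :
    teq (f ∘ (g + g')) (f ∘ g + f ∘ g')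
| teq_compZl m n p a (f : term n p) (g : term m n) :
    teq ((a *: f) ∘ g) (a *: (f ∘ g))
| teq_compZr m n p a (f : term n p) (g : term m n) :
    teq (f ∘ (a *: g)) (a *: (f ∘ g))
| teq_tens1 m n : teq (tid m ⊗ tid n) (tid (m + n))
| teq_interchange m n p m' n' p' (f : term n p) (g : term m n)
    (f' : term n' p') (g' : term m' n') :
    teq ((f ∘ g) ⊗ (f' ∘ g')) ((f ⊗ f') ∘ (g ⊗ g'))
| teq_tensA m n m' n' m'' n'' (f : term m n) (g : term m' n')
    (h : term m'' n'') :
    teq (tcast (addnA _ _ _) (addnA _ _ _) (f ⊗ (g ⊗ h))) (f ⊗ g ⊗ h)
| teq_tens1l m n (f : term m n) :
    teq (tcast (add0n _) (add0n _) (tid 0 ⊗ f)) f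
| teq_tens1r m n (f : term m n) :
    teq (tcast (addn0 _) (addn0 _) (f ⊗ tid 0)) f
| teq_tensDl m n m' n' (f f' : term m n) (g : term m' n') :
    teq ((f + f') ⊗ g) (f ⊗ g + f' ⊗ g)
| teq_tensDr m n m' n' (f : term m n) (g g' : term m' n') :
    teq (f ⊗ (g + g')) (f ⊗ g + f ⊗ g')
| teq_tensZl m n m' n' a (f : term m n) (g : term m' n') :
    teq ((a *: f) ⊗ g) (a *: (f ⊗ g))
| teq_tensZr m n m' n' a (f : term m n) (g : term m' n') :
    teq (f ⊗ (a *: g)) (a *: (f ⊗ g))
| teq_R1l : teq ((tcap ⊗ tid 1) ∘ (tid 1 ⊗ tcup)) (tid 1)
| teq_R1r : teq ((tid 1 ⊗ tcap) ∘ (tcup ⊗ tid 1)) (tid 1)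
| teq_R2 : teq tsplit ((tmerge ⊗ tid 1) ∘ (tid 1 ⊗ tcup))
| teq_R3m : teq ((tid 1 ⊗ tcap) ∘ (tsigm ⊗ tid 1))
                ((tcap ⊗ tid 1) ∘ (tid 1 ⊗ tsigp))
| teq_R3p : teq ((tid 1 ⊗ tcap) ∘ (tsigp ⊗ tid 1))
                ((tcap ⊗ tid 1) ∘ (tid 1 ⊗ tsigm))
| teq_R4l : teq (tsigm ∘ tsigp) (tid 2)
| teq_R4r : teq (tsigp ∘ tsigm) (tid 2)
| teq_R5 : teq ((tsigp ⊗ tid 1) ∘ (tid 1 ⊗ tsigp) ∘ (tsigp ⊗ tid 1))
               ((tid 1 ⊗ tsigp) ∘ (tsigp ⊗ tid 1) ∘ (tid 1 ⊗ tsigp))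
| teq_R6 : teq ((tid 1 ⊗ tmerge) ∘ (tsigp ⊗ tid 1) ∘ (tid 1 ⊗ tsigp))
               (tsigp ∘ (tmerge ⊗ tid 1))
| teq_R7 : teq ((tid 1 ⊗ tsigp) ∘ (tsigp ⊗ tid 1) ∘ (tid 1 ⊗ tsplit))
               ((tsplit ⊗ tid 1) ∘ tsigp)
| teq_R8cap : teq (tcap ∘ tsigp) (beta *: tcap)
| teq_R8merge : teq (tmerge ∘ tsigp) (tau *: tmerge)
| teq_R8bigon : teq (tmerge ∘ tsplit) (phi *: tid 1)
| teq_R8loop : teq (tcap ∘ tcup) (delta *: tid 0)
| teq_R8lollipop : teq (tmerge ∘ tcup) tzero.

HB.instance Definition _ m n := gen_eqMixin (term m n).
HB.instance Definition _ m n := gen_choiceMixin (term m n).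

Section Hom.
Variables m n : nat.

Definition teqb (f g : term m n) : bool := `[< teq f g >].

Lemma teqb_equiv : equiv_class_of teqb.
Proof.
split=> [f|f g|g f h].
- exact/asboolP/teq_refl.
- by apply/asboolP/asboolP; apply: teq_sym.
- by move=> /asboolP fg /asboolP gh; apply/asboolP/(teq_trans fg gh).
Qed.

Canonical teqb_equiv_rel := EquivRelPack teqb_equiv.

(* the space of morphisms from the m-th to the n-th tensor power in T *)
Definition Hom := {eq_quot teqb}.
HB.instance Definition _ := Choice.on Hom.
HB.instance Definition _ : EqQuotient _ teqb Hom := EqQuotient.on Hom.

Definition mor (f : term m n) : Hom := \pi_Hom f.

Lemma mor_eqP (f g : term m n) : mor f = mor g <-> teq f g.
Proof.
split=> [/eqP|fg]; first by rewrite piE => /asboolP.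
by apply/eqP; rewrite piE; apply/asboolP.
Qed.

Lemma teq_repr (f : term m n) : teq (repr (mor f)) f.
Proof. by apply/mor_eqP; rewrite /mor reprK. Qed.

Lemma mor_repr (f : Hom) : mor (repr f) = f.
Proof. exact: reprK. Qed.

Definition hadd (f g : Hom) : Hom := mor (repr f + repr g).
Definition hscale (a : Qq) (f : Hom) : Hom := mor (a *: repr f).

Lemma mor_add f g : mor (f + g) = hadd (mor f) (mor g).
Proof. by apply/mor_eqP/teq_add; apply/teq_sym/teq_repr. Qed.

Lemma mor_scale a f : mor (a *: f) = hscale a (mor f).
Proof. by apply/mor_eqP/teq_scale/teq_sym/teq_repr. Qed.

Lemma haddA : associative hadd.
Proof.
move=> f g h; rewrite -[f]mor_repr -[g]mor_repr -[h]mor_repr -!mor_add.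
exact/mor_eqP/teq_addA.
Qed.

Lemma haddC : commutative hadd.
Proof.
by move=> f g; rewrite -[f]mor_repr -[g]mor_repr -!mor_add; apply/mor_eqP/teq_addC.
Qed.

Lemma hadd0 : left_id (mor tzero) hadd.
Proof. by move=> f; rewrite -[f]mor_repr -mor_add; apply/mor_eqP/teq_add0. Qed.

Lemma hscaleDl f a b : hscale (a + b) f = hadd (hscale a f) (hscale b f).
Proof.
by rewrite -[f]mor_repr -!mor_scale -mor_add; apply/mor_eqP/teq_scaleDl.
Qed.

Lemma hscale1 : left_id 1 hscale.
Proof. by move=> f; rewrite -[f]mor_repr -mor_scale; apply/mor_eqP/teq_scale1. Qed.

Lemma haddN : left_inverse (mor tzero) (hscale (-1)) hadd.
Proof.
move=> f; rewrite -{2}[f]hscale1 -hscaleDl addNr -[f]mor_repr -mor_scale.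
exact/mor_eqP/teq_scale0.
Qed.

HB.instance Definition _ := GRing.isZmodule.Build Hom haddA haddC hadd0 haddN.

Lemma hscaleA a b f : hscale a (hscale b f) = hscale (a * b) f.
Proof. by rewrite -[f]mor_repr -!mor_scale; apply/mor_eqP/teq_scaleA. Qed.

Lemma hscaleDr : right_distributive hscale +%R.
Proof.
move=> a f g; rewrite -[f]mor_repr -[g]mor_repr -[_ + _ in LHS]mor_add -!mor_scale.
by rewrite -[_ + _ in RHS]mor_add; apply/mor_eqP/teq_scaleDr.
Qed.

HB.instance Definition _ :=
  GRing.Zmodule_isLmodule.Build Qq Hom hscaleA hscale1 hscaleDr hscaleDl.

Lemma morD f g : mor (f + g) = mor f + mor g. Proof. exact: mor_add. Qed.
Lemma morZ a f : mor (a *: f) = a *: mor f. Proof. exact: mor_scale. Qed.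
Lemma mor0 : mor tzero = 0. Proof. by []. Qed.

End Hom.

Definition hcomp m n p (f : Hom n p) (g : Hom m n) : Hom m p :=
  mor (repr f ∘ repr g).
Definition htens m n m' n' (f : Hom m n) (g : Hom m' n') :
  Hom (m + m') (n + n') := mor (repr f ⊗ repr g).

Lemma mor_comp m n p (f : term n p) (g : term m n) :
  mor (f ∘ g) = hcomp (mor f) (mor g).
Proof. by apply/mor_eqP/teq_comp; apply/teq_sym/teq_repr. Qed.

Lemma mor_tens m n m' n' (f : term m n) (g : term m' n') :
  mor (f ⊗ g) = htens (mor f) (mor g).
Proof. by apply/mor_eqP/teq_tens; apply/teq_sym/teq_repr. Qed.

Record tensor_ideal := TensorIdeal {
  ideal_mem :> forall m n, {pred Hom m n};
  ideal_submod : forall m n, submod_closed (@ideal_mem m n);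
  ideal_compl : forall m n p (f : Hom n p) (g : Hom m n),
    g \in @ideal_mem m n -> hcomp f g \in @ideal_mem m p;
  ideal_compr : forall m n p (f : Hom n p) (g : Hom m n),
    f \in @ideal_mem n p -> hcomp f g \in @ideal_mem m p;
  ideal_tensl : forall m n m' n' (f : Hom m n) (g : Hom m' n'),
    g \in @ideal_mem m' n' -> htens f g \in @ideal_mem (m + m') (n + n');
  ideal_tensr : forall m n m' n' (f : Hom m n) (g : Hom m' n'),
    f \in @ideal_mem m n -> htens f g \in @ideal_mem (m + m') (n + n')
}.

Arguments ideal_mem : clear implicits.

Section QuotientHom.
Variables (I : tensor_ideal) (m n : nat).

Definition ideal_pred : Hom m n -> bool := fun f => f \in I m n.

Lemma ideal_pred_zmod : zmod_closed ideal_pred.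
Proof. exact: (ideal_submod I m n). Qed.

HB.instance Definition _ :=
  GRing.isZmodClosed.Build (Hom m n) ideal_pred ideal_pred_zmod.

Definition ideal_at : zmodClosed (Hom m n) :=
  GRing.ZmodClosed.clone (Hom m n) ideal_pred _.

(* the corresponding space of morphisms in T/I *)
Definition QHom := Quotient.quot ideal_at.
HB.instance Definition _ := GRing.Zmodule.on QHom.

Definition qproj (f : Hom m n) : QHom := \pi_(Quotient.quot ideal_at) f.

Lemma qprojD f g : qproj (f + g) = qproj f + qproj g.
Proof. exact: pi_addr. Qed.

Lemma qproj_repr f : qproj (repr (f : Quotient.quot ideal_at)) = f.
Proof. exact: reprK. Qed.

Lemma qprojP f g : qproj f = qproj g <-> f - g \in I m n.
Proof.
split=> [/eqP|fg]; first by rewrite /qproj -Quotient.idealrBE.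
by apply/eqP; rewrite /qproj -Quotient.idealrBE.
Qed.

Lemma qproj_eq0 f : qproj f = 0 <-> f \in I m n.
Proof.
have -> : 0 = qproj 0 by symmetry; exact: pi_zeror.
by rewrite qprojP subr0.
Qed.

Definition qscale (a : Qq) (f : QHom) : QHom :=
  qproj (a *: repr (f : Quotient.quot ideal_at)).

Lemma qproj_scale a f : qproj (a *: f) = qscale a (qproj f).
Proof.
apply/qprojP; rewrite -scalerBr -[a *: _]addr0.
have [I0 Ilin] := ideal_submod I m n; apply: Ilin => //.
by apply/qprojP; rewrite qproj_repr.
Qed.

Lemma qscaleA a b f : qscale a (qscale b f) = qscale (a * b) f.
Proof. by rewrite -[f]qproj_repr -!qproj_scale scalerA. Qed.

Lemma qscale1 : left_id 1 qscale.
Proof. by move=> f; rewrite -[f]qproj_repr -qproj_scale scale1r. Qed.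

Lemma qscaleDr : right_distributive qscale +%R.
Proof.
move=> a f g; rewrite -[f]qproj_repr -[g]qproj_repr -qprojD -!qproj_scale.
by rewrite -qprojD scalerDr.
Qed.

Lemma qscaleDl f a b : qscale (a + b) f = qscale a f + qscale b f.
Proof. by rewrite -[f]qproj_repr -!qproj_scale -qprojD scalerDl. Qed.

HB.instance Definition _ :=
  GRing.Zmodule_isLmodule.Build Qq QHom qscaleA qscale1 qscaleDr qscaleDl.

(* the image in T/I of the morphism denoted by a formal diagram; composites and
   tensor products in T/I are by definition the images of those in T *)
Definition qmor (f : term m n) : QHom := qproj (mor f).

Lemma qprojZ a f : qproj (a *: f) = a *: qproj f.
Proof. exact: qproj_scale. Qed.

End QuotientHom.

Section LinearAlgebra.
Variables (K : fieldType) (V : lmodType K) (d : nat).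
Implicit Type v : d.-tuple V.

Definition lin_indep v : Prop :=
  forall c : 'I_d -> K,
    \sum_(i < d) c i *: tnth v i = 0 -> forall i, c i = 0.

Definition spanning v : Prop :=
  forall x : V, exists c : 'I_d -> K, x = \sum_(i < d) c i *: tnth v i.

Definition is_basis v : Prop := lin_indep v /\ spanning v.

End LinearAlgebra.

(* V is finite-dimensional, of dimension at most d; vectType cannot be used, since
   V is not known to be finite-dimensional beforehand *)
Definition dim_le (K : fieldType) (V : lmodType K) (d : nat) : Prop :=
  exists v : d.-tuple V, spanning v.

Local Open Scope term_scope.

Definition tU : term 2 2 := tcup ∘ tcap.
Definition tH : term 2 2 := (tmerge ⊗ tid 1) ∘ (tid 1 ⊗ tsplit).
Definition tN : term 2 2 := tsplit ∘ tmerge.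

Definition tQs : 5.-tuple (term 2 3) := [tuple
  (tid 1 ⊗ tmerge ⊗ tid 1) ∘ (tsplit ⊗ tsplit);
  (tsplit ⊗ tid 1) ∘ tsplit ∘ tmerge;
  (tid 1 ⊗ tsplit) ∘ tsplit ∘ tmerge;
  (tid 1 ⊗ tsplit) ∘ tH;
  (tsplit ⊗ tid 1) ∘ tH].

Definition tP : term 2 3 := (tid 1 ⊗ tmerge ⊗ tid 1) ∘ (tsplit ⊗ tsplit) ∘ tH.

Definition tNs : 5.-tuple (term 2 3) := [tuple
  (tid 1 ⊗ tsplit) ∘ tcup ∘ tcap;
  tid 1 ⊗ tsplit;
  tsplit ⊗ tid 1;
  tcup ⊗ tmerge;
  tmerge ⊗ tcup].

Definition tXs : 5.-tuple (term 2 3) := [tuple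
  (tid 1 ⊗ tsigp) ∘ (tcup ⊗ tmerge);
  (tid 1 ⊗ tsigm) ∘ (tsplit ⊗ tid 1);
  (tsigp ⊗ tid 1) ∘ (tid 1 ⊗ tsplit);
  (tsplit ⊗ tid 1) ∘ tsigp;
  (tid 1 ⊗ tsplit) ∘ tsigm].

(* Main.v *)
(* In the basis [1, U, H, N, s+ + s-] of [Hom(2, 2)], which the quarter rotation
   permutes, [s+ - s-] is antisymmetric, so [s+ - s- = c (1 - U) + d (H - N)].
   Write [s+ H] in the basis [1, U, H, N, s+]: stacking [s+] on top of the
   rotation of [s+ H] gives [tau H], which forces the coefficient [a4] of [N] to
   satisfy [a4 ^ 3 = - q ^ 24], hence [a4 = - q ^ 8] because [Q(q)] contains no
   primitive cube root of unity. Closing with a cap and with a merge then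
   determines [s+ H], the triangle, [c = d], [s- H] and [H ^ 2].
   The sixteen morphisms [P, Q_j, N_j, X_j], bent to [Hom(3, 2)], are linearly
   dependent by the dimension bound. Merging two adjacent strands of each of
   the five rotations of a dependency gives linear equations whose solutions
   are the multiples of the asserted relation. *)

From Pilot Require Import Defs.
From HB Require Import structures.
From mathcomp Require Import all_boot all_order all_algebra.
From mathcomp Require Import generic_quotient ring_quotient.
From mathcomp Require boolp.
From mathcomp Require Import zify ring.

Set Implicit Arguments.
Unset Strict Implicit.
Unset Printing Implicit Defensive.

Import GRing.Theory.
Import Pilot.Defs.
Local Open Scope ring_scope.

(** * Composition and tensor product in the quotient *)

(** The system for the sixteen coefficients has a Z/5 symmetry, and this is what makes it solvable
    by hand. Eliminating the trees leaves a recursion on the five crossing coefficients alone. A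
    nonconstant solution made of the powers of a primitive fifth root of unity w would force the
    constant [golden_arg] to equal w^2 + w^3, a root of z^2 + z - 1. It is no such root, so all
    coefficients are invariant under rotation and only three unknowns remain, proportional to the
    coefficient of the pentagon. On the diagrammatic side the obstacle is strictness, which equates
    terms of different types. Morphisms are therefore bundled with their ends, diagrams become words
    of layers, and each identity is a list of rewriting moves checked by computation. Rotating,
    closing, merging and bending are all insertions into a fixed diagram, hence linear for one
    common reason. Nearly all denominators are powers of q times cyclotomic factors, so they are
    invertible because q is no root of unity. *)

Section QuotientCategory.
Variable I : tensor_ideal.

Lemma qmorD m n (f g : term m n) : qmor I (f + g)%T = qmor I f + qmor I g.
Proof. by rewrite /qmor morD qprojD. Qed.

Lemma qmorZ m n a (f : term m n) : qmor I (a *: f)%T = a *: qmor I f.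
Proof. by rewrite /qmor morZ qprojZ. Qed.

Lemma qmor_teq m n (f g : term m n) : teq f g -> qmor I f = qmor I g.
Proof. by move=> /mor_eqP fg; rewrite /qmor fg. Qed.

Definition qrep m n (x : QHom I m n) : term m n :=
  repr (repr (x : Quotient.quot (ideal_at I m n)) : Hom m n).

Lemma qrepK m n (x : QHom I m n) : qmor I (qrep x) = x.
Proof. by rewrite /qmor /qrep mor_repr qproj_repr. Qed.

Lemma mor_sub m n (f g : term m n) : mor (f + (-1) *: g)%T = mor f - mor g.
Proof. by rewrite morD morZ scaleN1r. Qed.

Lemma qmorP m n (f g : term m n) :
  qmor I f = qmor I g <-> mor (f + (-1) *: g)%T \in I m n.
Proof. by rewrite mor_sub; apply: qprojP. Qed.

(** By bilinearity the difference of the composites is the composite of a difference, which the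
    ideal absorbs. *)
Lemma qmor_congl m n p (f f' : term n p) (g : term m n) :
  qmor I f = qmor I f' -> qmor I (f ∘ g)%T = qmor I (f' ∘ g)%T.
Proof.
move=> /qmorP ff'; apply/qmorP.
have -> : mor (f ∘ g + (-1) *: (f' ∘ g))%T = hcomp (mor (f + (-1) *: f')%T) (mor g).
  rewrite -mor_comp; apply/mor_eqP/teq_sym.
  apply: teq_trans (teq_compDl _ _ _) _; apply: teq_add; first exact: teq_refl.
  exact: teq_compZl.
exact: ideal_compr.
Qed.

Lemma qmor_congr m n p (f : term n p) (g g' : term m n) :
  qmor I g = qmor I g' -> qmor I (f ∘ g)%T = qmor I (f ∘ g')%T.
Proof.
move=> /qmorP gg'; apply/qmorP.
have -> : mor (f ∘ g + (-1) *: (f ∘ g'))%T = hcomp (mor f) (mor (g + (-1) *: g')%T).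
  rewrite -mor_comp; apply/mor_eqP/teq_sym.
  apply: teq_trans (teq_compDr _ _ _) _; apply: teq_add; first exact: teq_refl.
  exact: teq_compZr.
exact: ideal_compl.
Qed.

Lemma qmor_tensl m n m' n' (f f' : term m n) (g : term m' n') :
  qmor I f = qmor I f' -> qmor I (f ⊗ g)%T = qmor I (f' ⊗ g)%T.
Proof.
move=> /qmorP ff'; apply/qmorP.
have -> : mor (f ⊗ g + (-1) *: (f' ⊗ g))%T = htens (mor (f + (-1) *: f')%T) (mor g).
  rewrite -mor_tens; apply/mor_eqP/teq_sym.
  apply: teq_trans (teq_tensDl _ _ _) _; apply: teq_add; first exact: teq_refl.
  exact: teq_tensZl.
exact: ideal_tensr.
Qed.

Lemma qmor_tensr m n m' n' (f : term m n) (g g' : term m' n') :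
  qmor I g = qmor I g' -> qmor I (f ⊗ g)%T = qmor I (f ⊗ g')%T.
Proof.
move=> /qmorP gg'; apply/qmorP.
have -> : mor (f ⊗ g + (-1) *: (f ⊗ g'))%T = htens (mor f) (mor (g + (-1) *: g')%T).
  rewrite -mor_tens; apply/mor_eqP/teq_sym.
  apply: teq_trans (teq_tensDr _ _ _) _; apply: teq_add; first exact: teq_refl.
  exact: teq_tensZr.
exact: ideal_tensl.
Qed.

Definition qid n : QHom I n n := qmor I (tid n).
Definition qcomp m n p (f : QHom I n p) (g : QHom I m n) : QHom I m p :=
  qmor I (qrep f ∘ qrep g)%T.
Definition qtens m n m' n' (f : QHom I m n) (g : QHom I m' n') :
  QHom I (m + m') (n + n') := qmor I (qrep f ⊗ qrep g)%T.

(** Independence of the representatives chosen by [qrep]. The axioms in [teq] then pass to T/I by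
    rewriting with [qrepK]. *)
Lemma qmor_comp m n p (f : term n p) (g : term m n) :
  qmor I (f ∘ g)%T = qcomp (qmor I f) (qmor I g).
Proof.
rewrite /qcomp (@qmor_congl _ _ _ f (qrep (qmor I f))) ?qrepK //.
by apply: qmor_congr; rewrite qrepK.
Qed.

Lemma qmor_tens m n m' n' (f : term m n) (g : term m' n') :
  qmor I (f ⊗ g)%T = qtens (qmor I f) (qmor I g).
Proof.
rewrite /qtens (@qmor_tensl _ _ _ _ f (qrep (qmor I f))) ?qrepK //.
by apply: qmor_tensr; rewrite qrepK.
Qed.

Lemma qcompA m n p r (f : QHom I p r) (g : QHom I n p) (h : QHom I m n) :
  qcomp f (qcomp g h) = qcomp (qcomp f g) h.
Proof.
rewrite -[f]qrepK -[g]qrepK -[h]qrepK -!qmor_comp.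
exact/qmor_teq/teq_compA.
Qed.

Lemma qcomp1l m n (f : QHom I m n) : qcomp (qid n) f = f.
Proof. by rewrite -[f]qrepK -qmor_comp; apply/qmor_teq/teq_comp1l. Qed.

Lemma qcomp1r m n (f : QHom I m n) : qcomp f (qid m) = f.
Proof. by rewrite -[f]qrepK -qmor_comp; apply/qmor_teq/teq_comp1r. Qed.

Lemma qcompDl m n p (f f' : QHom I n p) (g : QHom I m n) :
  qcomp (f + f') g = qcomp f g + qcomp f' g.
Proof.
rewrite -[f]qrepK -[f']qrepK -[g]qrepK -qmorD -!qmor_comp -qmorD.
exact/qmor_teq/teq_compDl.
Qed.

Lemma qcompDr m n p (f : QHom I n p) (g g' : QHom I m n) :
  qcomp f (g + g') = qcomp f g + qcomp f g'.
Proof.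
rewrite -[f]qrepK -[g']qrepK -[g]qrepK -qmorD -!qmor_comp -qmorD.
exact/qmor_teq/teq_compDr.
Qed.

Lemma qcompZl m n p a (f : QHom I n p) (g : QHom I m n) :
  qcomp (a *: f) g = a *: qcomp f g.
Proof.
rewrite -[f]qrepK -[g]qrepK -qmorZ -!qmor_comp -qmorZ.
exact/qmor_teq/teq_compZl.
Qed.

Lemma qcompZr m n p a (f : QHom I n p) (g : QHom I m n) :
  qcomp f (a *: g) = a *: qcomp f g.
Proof.
rewrite -[f]qrepK -[g]qrepK -qmorZ -!qmor_comp -qmorZ.
exact/qmor_teq/teq_compZr.
Qed.

Lemma qtens1 m n : qtens (qid m) (qid n) = qid (m + n).
Proof. by rewrite -qmor_tens; apply/qmor_teq/teq_tens1. Qed.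

Lemma qinterchange m n p m' n' p' (f : QHom I n p) (g : QHom I m n)
    (f' : QHom I n' p') (g' : QHom I m' n') :
  qtens (qcomp f g) (qcomp f' g') = qcomp (qtens f f') (qtens g g').
Proof.
rewrite -[f]qrepK -[g]qrepK -[f']qrepK -[g']qrepK -!(qmor_comp, qmor_tens).
exact/qmor_teq/teq_interchange.
Qed.

Lemma qtensDr m n m' n' (f : QHom I m n) (g g' : QHom I m' n') :
  qtens f (g + g') = qtens f g + qtens f g'.
Proof.
rewrite -[f]qrepK -[g']qrepK -[g]qrepK -qmorD -!qmor_tens -qmorD.
exact/qmor_teq/teq_tensDr.
Qed.

Lemma qtensDl m n m' n' (f f' : QHom I m n) (g : QHom I m' n') :
  qtens (f + f') g = qtens f g + qtens f' g.
Proof.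
rewrite -[f]qrepK -[f']qrepK -[g]qrepK -qmorD -!qmor_tens -qmorD.
exact/qmor_teq/teq_tensDl.
Qed.

Lemma qtensZr m n m' n' a (f : QHom I m n) (g : QHom I m' n') :
  qtens f (a *: g) = a *: qtens f g.
Proof.
rewrite -[f]qrepK -[g]qrepK -qmorZ -!qmor_tens -qmorZ.
exact/qmor_teq/teq_tensZr.
Qed.

Lemma qtensZl m n m' n' a (f : QHom I m n) (g : QHom I m' n') :
  qtens (a *: f) g = a *: qtens f g.
Proof.
rewrite -[f]qrepK -[g]qrepK -qmorZ -!qmor_tens -qmorZ.
exact/qmor_teq/teq_tensZl.
Qed.

(* Morphisms bundled with their source and target: strict associativity and
   unitality of the tensor product become equalities, without casts. *)
Definition arrow := {mn : nat * nat & QHom I mn.1 mn.2}.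
Definition src (F : arrow) : nat := (tag F).1.
Definition tgt (F : arrow) : nat := (tag F).2.
Definition arr m n (f : QHom I m n) : arrow :=
  existT (fun mn : nat * nat => QHom I mn.1 mn.2) (m, n) f.

Lemma arr_cast m n m' n' (em : m = m') (en : n = n') (f : term m n) :
  arr (qmor I (tcast em en f)) = arr (qmor I f).
Proof. by case: m' / em; case: n' / en. Qed.

Definition qcast m n m' n' (em : m = m') (en : n = n') (f : QHom I m n) :
    QHom I m' n' :=
  ecast i (QHom I i n') em (ecast j (QHom I m j) en f).

(* Junk value [F] when the two arrows cannot be composed. *)
Definition acomp (F G : arrow) : arrow :=
  if eqVneq (tgt G) (src F) is EqNotNeq e then
    arr (qcomp (tagged F) (qcast erefl e (tagged G)))
  else F.

Definition atens (F G : arrow) : arrow := arr (qtens (tagged F) (tagged G)).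
Definition ascale (a : Qq) (F : arrow) : arrow := arr (a *: tagged F).
Definition aid n : arrow := arr (qid n).

Lemma acomp_arr m n p (f : QHom I n p) (g : QHom I m n) :
  acomp (arr f) (arr g) = arr (qcomp f g).
Proof.
rewrite /acomp; case: eqVneq => [e|]; last by rewrite eqxx.
by rewrite (eq_irrelevance e erefl).
Qed.

Lemma arrow_ind (P : arrow -> Prop) :
  (forall m n (f : QHom I m n), P (arr f)) -> forall F, P F.
Proof. by move=> Parr [[m n] f]; apply: Parr. Qed.

Lemma src_tens F G : src (atens F G) = (src F + src G)%N. Proof. by []. Qed.
Lemma tgt_tens F G : tgt (atens F G) = (tgt F + tgt G)%N. Proof. by []. Qed.

Lemma src_comp F G : tgt G = src F -> src (acomp F G) = src G.
Proof.
by elim/arrow_ind: F => n p f; elim/arrow_ind: G => m n' g /= e;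
   rewrite /tgt/src/= in e; case: n / e f => f; rewrite acomp_arr.
Qed.

Lemma tgt_comp F G : tgt G = src F -> tgt (acomp F G) = tgt F.
Proof.
by elim/arrow_ind: F => n p f; elim/arrow_ind: G => m n' g /= e;
   rewrite /tgt/src/= in e; case: n / e f => f; rewrite acomp_arr.
Qed.

Lemma acompA F G H : tgt H = src G -> tgt G = src F ->
  acomp F (acomp G H) = acomp (acomp F G) H.
Proof.
elim/arrow_ind: F => p r f; elim/arrow_ind: G => n p' g.
elim/arrow_ind: H => m n' h; rewrite /tgt/src/= => en ep.
case: n / en g => g; case: p / ep f => f.
by rewrite !acomp_arr qcompA.
Qed.

Lemma acomp1l n F : tgt F = n -> acomp (aid n) F = F.
Proof. by elim/arrow_ind: F => m p f <-; rewrite acomp_arr qcomp1l. Qed.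

Lemma acomp1r n F : src F = n -> acomp F (aid n) = F.
Proof. by elim/arrow_ind: F => m p f <-; rewrite acomp_arr qcomp1r. Qed.

(** For arrows that do not compose, both sides are the junk value [ascale a F]. *)
Lemma acompZl a F G : acomp (ascale a F) G = ascale a (acomp F G).
Proof.
elim/arrow_ind: F => n p f; elim/arrow_ind: G => m n' g.
have [e|ne] := eqVneq n' n.
  by case: n / e f => f; rewrite /ascale !acomp_arr /= qcompZl.
rewrite /acomp /= /tgt /src /=.
by case: eqVneq => [e|//]; rewrite e eqxx in ne.
Qed.

Lemma acompZr a F G : tgt G = src F -> acomp F (ascale a G) = ascale a (acomp F G).
Proof.
elim/arrow_ind: F => n p f; elim/arrow_ind: G => m n' g; rewrite /tgt/src/= => e.
by case: n / e f => f; rewrite /ascale !acomp_arr /= qcompZr.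
Qed.

Lemma atensZl a F G : atens (ascale a F) G = ascale a (atens F G).
Proof. by rewrite /atens /ascale /= qtensZl. Qed.

Lemma atensZr a F G : atens F (ascale a G) = ascale a (atens F G).
Proof. by rewrite /atens /ascale /= qtensZr. Qed.

Lemma ascaleA a b F : ascale a (ascale b F) = ascale (a * b) F.
Proof. by rewrite /ascale /= scalerA. Qed.

Lemma atens1 m n : atens (aid m) (aid n) = aid (m + n).
Proof. by rewrite /atens /aid /= qtens1. Qed.

Lemma ainterchange F G F' G' : tgt G = src F -> tgt G' = src F' ->
  acomp (atens F F') (atens G G') = atens (acomp F G) (acomp F' G').
Proof.
elim/arrow_ind: F => n p f; elim/arrow_ind: G => m n1 g; rewrite /tgt/src/= => e.
case: n / e f => f.
elim/arrow_ind: F' => n' p' f'; elim/arrow_ind: G' => m' n1' g'.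
rewrite /tgt/src/= => e; case: n' / e f' => f'.
by rewrite /atens !acomp_arr qinterchange.
Qed.

Lemma atensA F G H : atens F (atens G H) = atens (atens F G) H.
Proof.
elim/arrow_ind: F => m n f; elim/arrow_ind: G => m' n' g.
elim/arrow_ind: H => m'' n'' h; rewrite /atens /=.
rewrite -[f]qrepK -[g]qrepK -[h]qrepK -!qmor_tens.
rewrite -(qmor_teq (teq_tensA (qrep f) (qrep g) (qrep h))).
by rewrite arr_cast.
Qed.

Lemma atens1l F : atens (aid 0) F = F.
Proof.
elim/arrow_ind: F => m n f; rewrite /atens /= -[f]qrepK -qmor_tens.
by rewrite -[in RHS](qmor_teq (teq_tens1l (qrep f))) arr_cast.
Qed.

Lemma atens1r F : atens F (aid 0) = F.
Proof.
elim/arrow_ind: F => m n f; rewrite /atens /= -[f]qrepK -qmor_tens.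
by rewrite -[in RHS](qmor_teq (teq_tens1r (qrep f))) arr_cast.
Qed.

End QuotientCategory.

(** * Equality of diagrams by certified rewriting *)

(** [Split] is a derived morphism but gets its own letter, which keeps words short; [split_l] and
    [split_r] unfold it and fold it back. *)
Inductive gen := Merge | Pos | Neg | Cup | Cap | Split.

Definition gdom g :=
  match g with Cup => 0 | Split => 1 | _ => 2 end%N.
Definition gcod g :=
  match g with Cap => 0 | Merge => 1 | _ => 2 end%N.

Definition gterm g : term (gdom g) (gcod g) :=
  match g with
  | Merge => tmerge | Pos => tsigp | Neg => tsigm
  | Cup => tcup | Cap => tcap | Split => tsplit
  end.

Definition gen_code g : nat :=
  match g with
  | Merge => 0 | Pos => 1 | Neg => 2 | Cup => 3 | Cap => 4 | Split => 5
  end%N.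
Lemma gen_code_inj : injective gen_code. Proof. by case; case. Qed.
HB.instance Definition _ := Equality.copy gen (inj_type gen_code_inj).

(* A diagram is read bottom to top as a sequence of layers; the layer [(i, g)]
   is the generator [g] with [i] strands to its left. *)
Definition word := seq (nat * gen).

Definition step n (l : nat * gen) := (n - gdom l.2 + gcod l.2)%N.
Definition out n (w : word) := foldl step n w.
Fixpoint valid n (w : word) :=
  if w is l :: w' then (l.1 + gdom l.2 <= n)%N && valid (step n l) w' else true.
Definition shift i (w : word) : word := [seq ((i + l.1)%N, l.2) | l <- w].

Lemma out_cat n u v : out n (u ++ v) = out (out n u) v.
Proof. exact: foldl_cat. Qed.

Lemma valid_cat n u v : valid n (u ++ v) = valid n u && valid (out n u) v.
Proof. by elim: u n => //= l u IH n; rewrite IH andbA. Qed.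

Lemma out_shift n i j w : valid n w -> out (i + (n + j)) (shift i w) =
  (i + (out n w + j))%N.
Proof.
elim: w n => //= -[k g] w IH n /andP[kn vw]; rewrite -(IH _ vw); congr (out _ _).
by rewrite /step /= in kn *; lia.
Qed.

Lemma valid_shift n i j w : valid n w -> valid (i + (n + j)) (shift i w).
Proof.
elim: w n => //= -[k g] w IH n /andP[kn vw]; apply/andP; split => /=.
  by rewrite /= in kn; lia.
have := IH _ vw; congr (valid _ _).
by rewrite /step /= in kn *; lia.
Qed.

Section Evaluation.
Variable I : tensor_ideal.

Definition garr g : arrow I := arr (qmor I (gterm g)).

Definition layer n (l : nat * gen) : arrow I :=
  atens (aid I l.1) (atens (garr l.2) (aid I (n - (l.1 + gdom l.2)))).

Fixpoint ev n (w : word) : arrow I :=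
  if w is l :: w' then acomp (ev (step n l) w') (layer n l) else aid I n.

Lemma src_layer n l : (l.1 + gdom l.2 <= n)%N -> src (layer n l) = n.
Proof. by rewrite /src /=; lia. Qed.

Lemma tgt_layer n l : (l.1 + gdom l.2 <= n)%N -> tgt (layer n l) = step n l.
Proof. by rewrite /tgt /step /=; lia. Qed.

Lemma src_tgt_ev n w : valid n w -> src (ev n w) = n /\ tgt (ev n w) = out n w.
Proof.
elim: w n => //= l w IH n /andP[ln /IH[sw tw]].
have e : tgt (layer n l) = src (ev (step n l) w) by rewrite tgt_layer.
by rewrite src_comp // tgt_comp // src_layer.
Qed.

Lemma src_ev n w : valid n w -> src (ev n w) = n.
Proof. by case/src_tgt_ev. Qed.

Lemma tgt_ev n w : valid n w -> tgt (ev n w) = out n w.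
Proof. by case/src_tgt_ev. Qed.

Lemma ev_cat n u v : valid n (u ++ v) ->
  ev n (u ++ v) = acomp (ev (out n u) v) (ev n u).
Proof.
elim: u n => [|l u IH] n /=; first by move=> vv; rewrite acomp1r ?src_ev.
case/andP=> ln vuv; rewrite IH //; move: vuv; rewrite valid_cat => /andP[vu vv].
by rewrite acompA ?tgt_layer ?tgt_ev ?src_ev.
Qed.

Lemma layer_shift n i j l : (l.1 + gdom l.2 <= n)%N ->
  layer (i + (n + j)) ((i + l.1)%N, l.2) =
  atens (aid I i) (atens (layer n l) (aid I j)).
Proof.
case: l => k g /= kn; rewrite /layer /=.
have -> : (i + (n + j) - (i + k + gdom g) = n - (k + gdom g) + j)%N by lia.
by rewrite -!atens1 -!atensA.
Qed.

Lemma ev_shift n i j w : valid n w ->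
  ev (i + (n + j)) (shift i w) = atens (aid I i) (atens (ev n w) (aid I j)).
Proof.
elim: w n => [|l w IH] n /=; first by rewrite !atens1.
case/andP=> ln vw; rewrite layer_shift //.
have -> : step (i + (n + j)) ((i + l.1)%N, l.2) = (i + (step n l + j))%N.
  by rewrite /step /=; lia.
have e : tgt (layer n l) = src (ev (step n l) w) by rewrite tgt_layer ?src_ev.
have e' : tgt (atens (layer n l) (aid I j)) = src (atens (ev (step n l) w) (aid I j)).
  by rewrite [LHS]tgt_tens [RHS]src_tens e.
by rewrite IH // !ainterchange // !acomp1l.
Qed.

(** Interchange law: once the strands are cut into blocks [i], [g], [c], [h], [d], both sides are
    the tensor product of the two generators with identities. *)
Lemma layer_swap n i j g h : (i + gdom g <= j)%N -> (j + gdom h <= n)%N ->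
  acomp (layer (n - gdom g + gcod g) ((j - gdom g + gcod g)%N, h)) (layer n (i, g)) =
  acomp (layer (n - gdom h + gcod h) (i, g)) (layer n (j, h)).
Proof.
move=> ij jn.
have [c jE] : {c | j = (i + gdom g + c)%N} by exists (j - (i + gdom g))%N; lia.
have [d nE] : {d | n = (j + gdom h + d)%N} by exists (n - (j + gdom h))%N; lia.
(* The width [k] of the other block stays free, since that block is crossed before or after its own
   generator acts. *)
have L1 k : layer (i + gdom g + c + k + d) (i, g) =
    atens (aid I i) (atens (garr g) (atens (aid I c) (atens (aid I k) (aid I d)))).
  by rewrite /layer /= !atens1; congr (atens _ (atens _ (aid _ _))); lia.
have L2 k : layer (i + k + c + gdom h + d) ((i + k + c)%N, h) =
    atens (aid I i) (atens (aid I k) (atens (aid I c) (atens (garr h) (aid I d)))).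
  rewrite /layer /= -!atens1 -!atensA.
  by congr (atens _ (atens _ (atens _ (atens _ (aid _ _))))); lia.
have -> : (n - gdom g + gcod g = i + gcod g + c + gdom h + d)%N by lia.
have -> : (j - gdom g + gcod g = i + gcod g + c)%N by lia.
have -> : (n - gdom h + gcod h = i + gdom g + c + gcod h + d)%N by lia.
rewrite L2 L1 nE jE L1 L2.
have sg : src (garr g) = gdom g by []; have tg : tgt (garr g) = gcod g by [].
have sh : src (garr h) = gdom h by []; have th : tgt (garr h) = gcod h by [].
rewrite !ainterchange ?acomp1l ?acomp1r //.
Qed.

End Evaluation.

(** Scalars are symbols, so that derivations run by computation without evaluating anything in
    [Qq]. *)
Inductive atom := Abeta | Atau | Aphi | Adelta | Atri | Azero.

(* The triangle is [tri] times the trivalent vertex. *)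
Definition tri : Qq := - (q ^+ 6 + 1 + q ^- 6).

Definition atom_val a : Qq :=
  match a with
  | Abeta => beta | Atau => tau | Aphi => phi | Adelta => delta
  | Atri => tri | Azero => 0
  end.
Definition scal (s : seq atom) : Qq := \prod_(a <- s) atom_val a.

Lemma scal_cat s s' : scal (s ++ s') = scal s * scal s'.
Proof. exact: big_cat. Qed.

(* The equation [lscal * lhs = rscal * rhs] on [strands] strands; scalars on both
   sides make inverses unnecessary, e.g. [tau (m s-) = m]. *)
Record eqn := Eqn { strands : nat; lhs : word; rhs : word;
                    lscal : seq atom; rscal : seq atom }.

Section Laws.
Variable I : tensor_ideal.

Definition wf e :=
  [&& valid (strands e) (lhs e), valid (strands e) (rhs e)
    & out (strands e) (lhs e) == out (strands e) (rhs e)].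

Definition holds e := wf e /\
  ascale (scal (lscal e)) (ev I (strands e) (lhs e)) =
  ascale (scal (rscal e)) (ev I (strands e) (rhs e)).

Record law := Law { eqn_of :> eqn; _ : holds eqn_of }.

Definition flip e := Eqn (strands e) (rhs e) (lhs e) (rscal e) (lscal e).

Lemma holds_flip e : holds e -> holds (flip e).
Proof.
by move=> [/and3P[vl vr /eqP o] h]; split; rewrite // /wf /= vl vr o eqxx.
Qed.

Definition law_flip (L : law) : law := let: Law e h := L in Law (holds_flip h).

(** The number of strands to the left of an occurrence is read off its lowest layer. A wrong value
    is harmless, because [rewrite_at] compares the shifted law with the word. *)
Definition offset (w l : word) k := ((nth (0%N, Cup) w k).1 - (nth (0%N, Cup) l 0).1)%N.

(* [Fw L k] and [Bw L k] rewrite with the law [L], resp. from right to left, at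
   the layer [k]; [Ins L k i] rewrites backwards a law whose right-hand side is
   empty, with [i] strands to the left; [SwR k] and [SwL k] exchange the layers
   [k] and [k + 1] when the upper one is to the right, resp. to the left. *)
Inductive move :=
  | Fw of law & nat | Bw of law & nat | Ins of law & nat & nat
  | SwR of nat | SwL of nat.

Definition state := (word * seq atom * seq atom)%type.

(** The bound on strands ensures that the idle strands of the law are present too, which matching
    its layers does not show. *)
Definition rewrite_at n (L : law) k i (st : state) : option state :=
  let: (w, a, b) := st in
  let u := take k w in
  if [&& take (size (lhs L)) (drop k w) == shift i (lhs L)
       & (i + strands L <= out n u)%N]
  then Some (u ++ shift i (rhs L) ++ drop (k + size (lhs L)) w,
             a ++ lscal L, b ++ rscal L)
  else None.

Definition swapR (w : word) : option word :=
  if w is (i, g) :: (j, h) :: v then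
    if (i + gcod g <= j)%N
    then Some [:: ((j - gcod g + gdom g)%N, h), (i, g) & v] else None
  else None.

Definition swapL (w : word) : option word :=
  if w is (i, g) :: (j, h) :: v then
    if (j + gdom h <= i)%N
    then Some [:: (j, h), ((i - gdom h + gcod h)%N, g) & v] else None
  else None.

Definition swap_at (f : word -> option word) k (st : state) : option state :=
  let: (w, a, b) := st in
  omap (fun v => (take k w ++ v, a, b)) (f (drop k w)).

Definition apply_move n (m : move) (st : state) : option state :=
  match m with
  | Fw L k => rewrite_at n L k (offset st.1.1 (lhs L) k) st
  | Bw L k => rewrite_at n (law_flip L) k (offset st.1.1 (rhs L) k) st
  | Ins L k i => rewrite_at n (law_flip L) k i st
  | SwR k => swap_at swapR k st
  | SwL k => swap_at swapL k st
  end.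

Definition run n (ms : seq move) (w : word) : option state :=
  foldl (fun st m => obind (apply_move n m) st) (Some (w, [::], [::])) ms.

Definition reaches n w0 (st : state) := holds (Eqn n w0 st.1.1 st.1.2 st.2).

(** Isolates an occurrence of [w] as the middle factor, where a law can be substituted. *)
Lemma ev_context n u i d w v (j := (out n u - (i + d))%N) :
  valid n u -> valid d w -> (i + d <= out n u)%N -> valid (i + (out d w + j)) v ->
  ev I n (u ++ shift i w ++ v) =
  acomp (ev I (i + (out d w + j)) v)
    (acomp (atens (aid I i) (atens (ev I d w) (aid I j))) (ev I n u)).
Proof.
move=> vu vw iu vv; have uE : out n u = (i + (d + j))%N by rewrite /j; lia.
have vs : valid (out n u) (shift i w) by rewrite uE valid_shift.
have os : out (out n u) (shift i w) = (i + (out d w + j))%N by rewrite uE out_shift.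
have vsv : valid (out n u) (shift i w ++ v) by rewrite valid_cat vs os.
have vusv : valid n (u ++ shift i w ++ v) by rewrite valid_cat vu.
rewrite (ev_cat _ vusv) (ev_cat _ vsv) os [in ev _ _ (shift _ _)]uE ev_shift // acompA //.
  by rewrite tgt_ev // uE [RHS]src_tens src_tens src_ev.
by rewrite [LHS]tgt_tens tgt_tens tgt_ev // src_ev.
Qed.

Lemma valid_context n u i d w v (j := (out n u - (i + d))%N) :
  valid d w -> (i + d <= out n u)%N ->
  valid n (u ++ shift i w ++ v) = valid n u && valid (i + (out d w + j)) v.
Proof.
move=> vw iu; have uE : out n u = (i + (d + j))%N by rewrite /j; lia.
by rewrite !valid_cat [in valid _ (shift _ _)]uE valid_shift //=
  [in out _ (shift _ _)]uE out_shift.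
Qed.

Lemma out_context n u i d w v (j := (out n u - (i + d))%N) :
  valid d w -> (i + d <= out n u)%N ->
  out n (u ++ shift i w ++ v) = out (i + (out d w + j)) v.
Proof.
move=> vw iu; have uE : out n u = (i + (d + j))%N by rewrite /j; lia.
by rewrite !out_cat [in out (out _ _) (shift _ _)]uE out_shift.
Qed.

Lemma rewrite_sound n w0 (L : law) k i st st' : reaches n w0 st ->
  rewrite_at n L k i st = Some st' -> reaches n w0 st'.
Proof.
case: st => [[w a] b] [/= /and3P[/= v0 vw /eqP ow] e0].
case: ifP => // /andP[/eqP twk iu] [<-] {st'}.
case: L twk iu => -[d l r c1 c2] /= [/and3P[/= vl vr /eqP olr] eL] twk iu.
have wE : w = take k w ++ shift i l ++ drop (k + size l) w.
  by rewrite -twk addnC -drop_drop !cat_take_drop.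
move: wE vw ow e0 iu; set u := take k w; set v := drop _ w => -> vw ow e0 iu.
move: vw; rewrite (valid_context _ vl iu) => /andP[vu vv].
move: ow; rewrite (out_context _ vl iu) => ow.
move: e0; rewrite (ev_context vu vl iu vv) => e0.
rewrite olr in vv ow; split=> /=.
  rewrite /wf /= v0 (valid_context _ vr iu) (out_context _ vr iu) vu vv /=.
  exact/eqP.
rewrite (ev_context vu vr iu vv) !scal_cat [scal a * _]mulrC -[LHS]ascaleA e0 -olr.
rewrite ascaleA [scal c1 * _]mulrC -!ascaleA.
(* Scalars travel from the whole diagram to the occurrence, where [eL] applies. *)
have ctx_scale x F : tgt F = out d l -> src F = d ->
  ascale x (acomp (ev I (i + (out d l + (out n u - (i + d)))) v)
    (acomp (atens (aid I i) (atens F (aid I (out n u - (i + d))))) (ev I n u))) =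
  acomp (ev I (i + (out d l + (out n u - (i + d)))) v)
    (acomp (atens (aid I i) (atens (ascale x F) (aid I (out n u - (i + d))))) (ev I n u)).
  move=> tF sF; rewrite atensZl atensZr acompZl acompZr // tgt_comp ?src_ev ?olr //.
    by rewrite [LHS]tgt_tens tgt_tens tF olr.
  rewrite tgt_ev // [RHS]src_tens src_tens sF.
  by transitivity (i + (d + (out n u - (i + d))))%N; [lia | ].
by congr ascale; rewrite !ctx_scale ?tgt_ev ?src_ev // eL.
Qed.

Lemma swapR_sound n w w' : valid n w -> swapR w = Some w' ->
  [/\ valid n w', out n w' = out n w & ev I n w' = ev I n w].
Proof.
case: w => [|[i g] [|[j h] v]] //= /and3P[ig jh vv]; case: ifP => // ij [<-] /=.
rewrite /step /= in jh vv *.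
set j' := (j - gcod g + gdom g)%N.
have jE : j = (j' - gdom g + gcod g)%N by rewrite /j'; lia.
have E : (n - gdom g + gcod g - gdom h + gcod h = n - gdom h + gcod h - gdom g + gcod g)%N.
  by lia.
split; first by rewrite -E vv /j' andbT; apply/andP; split; lia.
  by rewrite E.
rewrite -E -!acompA; first 1 last.
- by rewrite tgt_layer // src_layer.
- by rewrite tgt_layer ?src_ev.
- by rewrite tgt_layer ?src_layer //= /j'; lia.
- by rewrite src_ev // E tgt_layer //=; lia.
by rewrite [in RHS]jE layer_swap //; rewrite /j'; lia.
Qed.

Lemma swapL_sound n w w' : valid n w -> swapL w = Some w' ->
  [/\ valid n w', out n w' = out n w & ev I n w' = ev I n w].
Proof.
case: w => [|[i g] [|[j h] v]] //= /and3P[ig jh vv]; case: ifP => // ij [<-] /=.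
rewrite /step /= in jh vv *.
have E : (n - gdom g + gcod g - gdom h + gcod h = n - gdom h + gcod h - gdom g + gcod g)%N.
  by lia.
split; first by rewrite -E vv andbT; apply/andP; split; lia.
  by rewrite E.
rewrite -E -!acompA; first 1 last.
- by rewrite tgt_layer // src_layer.
- by rewrite tgt_layer ?src_ev //.
- by rewrite tgt_layer ?src_layer //=; lia.
- by rewrite src_ev // E tgt_layer //=; lia.
by rewrite layer_swap.
Qed.

Lemma swap_sound f n w0 k st st' :
  (forall m w w', valid m w -> f w = Some w' ->
     [/\ valid m w', out m w' = out m w & ev I m w' = ev I m w]) ->
  reaches n w0 st -> swap_at f k st = Some st' -> reaches n w0 st'.
Proof.
move=> fP; case: st => [[w a] b] [/and3P[/= v0 vw /eqP ow] /= e0].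
case fE: (f _) => [v'|] //= [<-].
move: vw ow e0; rewrite -{1 2 3}(cat_take_drop k w) valid_cat => /andP[vu vv] ow e0.
have [v'' o' e'] := fP _ _ _ vv fE.
split=> /=; first by rewrite /wf /= v0 valid_cat vu v'' ow !out_cat o' eqxx.
by rewrite e0 !ev_cat ?valid_cat ?vu //= e'.
Qed.

Lemma move_sound n w0 m st st' :
  reaches n w0 st -> apply_move n m st = Some st' -> reaches n w0 st'.
Proof.
case: m => [L k|L k|L k i|k|k] /=; try exact: rewrite_sound.
  by apply: swap_sound => *; apply: swapR_sound.
by apply: swap_sound => *; apply: swapL_sound.
Qed.

(** The reflection principle. Scalars accumulate in the order of use and are compared as lists, so a
    law must list them in that order. *)
Lemma derive e ms : valid (strands e) (lhs e) ->
  run (strands e) ms (lhs e) = Some (rhs e, lscal e, rscal e) -> holds e.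
Proof.
move=> v0; suff H st : run (strands e) ms (lhs e) = Some st ->
    reaches (strands e) (lhs e) st by move/H; case: e {v0 H}.
elim/last_ind: ms st => [|ms m IH] st.
  by case=> <-; split; rewrite // /wf /= v0 eqxx.
rewrite /run -cats1 foldl_cat /= -/(run _ _ _).
by case: (run _ _ _) IH => [st'|] //= /(_ _ erefl) /move_sound; apply.
Qed.
End Laws.

Arguments SwR {I}.
Arguments SwL {I}.

(** A tensor product is drawn as (1 ⊗ g)(f ⊗ 1): the right factor is stacked above the left one,
    next to the [n] outputs of the latter. *)
Fixpoint flat m n (t : term m n) : word :=
  match t with
  | tcomp _ _ _ f g => flat g ++ flat f
  | ttens _ n _ _ f g => flat f ++ shift n (flat g)
  | tscale _ _ _ f => flat f
  | tmerge => [:: (0%N, Merge)]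
  | tsigp => [:: (0%N, Pos)]
  | tsigm => [:: (0%N, Neg)]
  | tcup => [:: (0%N, Cup)]
  | tcap => [:: (0%N, Cap)]
  | _ => [::]
  end.

Fixpoint monomial m n (t : term m n) : bool :=
  match t with
  | tcomp _ _ _ f g => monomial f && monomial g
  | ttens _ _ _ _ f g => monomial f && monomial g
  | tzero _ _ | tadd _ _ _ _ | tscale _ _ _ _ => false
  | _ => true
  end.

Section Flat.
Variable I : tensor_ideal.

Lemma ev_gen g : ev I (gdom g) [:: (0%N, g)] = garr I g.
Proof.
rewrite /= acomp1l; last by rewrite tgt_layer.
by rewrite /layer /= subnn atens1r atens1l.
Qed.

Lemma shift0 w : shift 0 w = w.
Proof. by elim: w => //= -[i g] w {2}<-. Qed.

Lemma flatP m n (t : term m n) : monomial t ->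
  [/\ valid m (flat t), out m (flat t) = n & ev I m (flat t) = arr (qmor I t)].
Proof.
elim: t => {m n}; try by split.
- move=> m n p f IHf g IHg /= /andP[/IHf[vf of_ ef] /IHg[vg og eg]].
  rewrite out_cat valid_cat og vg; split=> //.
  by rewrite ev_cat ?valid_cat og ?vg // ef eg acomp_arr qmor_comp.
- move=> m n m' n' f IHf g IHg /= /andP[/IHf[vf of_ ef] /IHg[vg og eg]].
  have := valid_shift 0 m' vf; rewrite shift0 add0n => vf'.
  have := out_shift 0 m' vf; rewrite shift0 !add0n of_ => of'.
  have := ev_shift I 0 m' vf; rewrite shift0 add0n ef atens1l => ef'.
  have := valid_shift n 0 vg; rewrite addn0 => vg'.
  have := out_shift n 0 vg; rewrite addn0 og addn0 => og'.
  have := ev_shift I n 0 vg; rewrite addn0 eg atens1r => eg'.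
  rewrite out_cat valid_cat of' vf' og'; split=> //.
  rewrite ev_cat ?valid_cat of' ?vf' // ef' eg'.
  rewrite ainterchange // acomp1l // acomp1r //.
  by rewrite qmor_tens.
- by split=> //; apply: (ev_gen Merge).
- by split=> //; apply: (ev_gen Pos).
- by split=> //; apply: (ev_gen Neg).
- by split=> //; apply: (ev_gen Cup).
- by split=> //; apply: (ev_gen Cap).
Qed.

Lemma holds_flat m n (f g : term m n) a b : monomial f && monomial g ->
  scal a *: qmor I f = scal b *: qmor I g ->
  holds I (Eqn m (flat f) (flat g) a b).
Proof.
move=> /andP[/flatP[vf of_ ef] /flatP[vg og eg]] fg; split=> /=.
  by rewrite /wf /= vf vg of_ og eqxx.
by rewrite ef eg /ascale /= fg.
Qed.

Lemma law_flat m n (f g : term m n) : teq f g -> monomial f && monomial g ->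
  holds I (Eqn m (flat f) (flat g) [::] [::]).
Proof. by move=> e fg; apply: holds_flat; rewrite // (qmor_teq I e). Qed.

Lemma law_flat_scale m n (f g : term m n) a :
  teq f (atom_val a *: g)%T -> monomial f && monomial g ->
  holds I (Eqn m (flat f) (flat g) [::] [:: a]).
Proof.
move=> e fg; apply: holds_flat; rewrite // (qmor_teq I e) qmorZ.
by rewrite /scal big_seq1 big_nil scale1r.
Qed.
End Flat.

(** * Words as vectors, and insertion into a fixed diagram as a linear map *)

Section Typed.
Variable I : tensor_ideal.

(* Junk value [0] when [F] is not a morphism from [m] to [n]. *)
Definition unarr m n (F : arrow I) : QHom I m n :=
  if eqVneq (src F) m is EqNotNeq em then
    if eqVneq (tgt F) n is EqNotNeq en then qcast em en (tagged F) else 0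
  else 0.

Lemma unarrK m n (f : QHom I m n) : unarr m n (arr f) = f.
Proof.
rewrite /unarr /src /tgt /=; case: eqVneq => [em|]; last by rewrite eqxx.
case: eqVneq => [en|]; last by rewrite eqxx.
by rewrite (eq_irrelevance em erefl) (eq_irrelevance en erefl).
Qed.

Lemma unarrZ m n a (F : arrow I) : unarr m n (ascale a F) = a *: unarr m n F.
Proof.
elim/arrow_ind: F => m' n' f; rewrite /unarr /ascale /src /tgt /=.
case: eqVneq => [em|]; last by rewrite scaler0.
case: eqVneq => [en|]; last by rewrite scaler0.
by case: m / em; case: n / en.
Qed.

Definition qw m n w : QHom I m n := unarr m n (ev I m w).

Lemma arr_qw m n w : valid m w -> out m w = n -> arr (qw m n w) = ev I m w.
Proof.
move=> vw <-; rewrite /qw; have [] := src_tgt_ev I vw.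
elim/arrow_ind: (ev I m w) => m' n'' f; rewrite /src /tgt /= => <- <-.
by rewrite unarrK.
Qed.

Lemma qw_law e n : holds I e ->
  scal (lscal e) *: qw (strands e) n (lhs e) =
  scal (rscal e) *: qw (strands e) n (rhs e).
Proof. by case=> _ h; rewrite -!unarrZ h. Qed.

Lemma qmor_qw m n (t : term m n) w ms : monomial t ->
  run (I := I) m ms (flat t) = Some (w, [::], [::]) -> qmor I t = qw m n w.
Proof.
move=> /(flatP I)[vt ot et] rt.
have /(@qw_law _ n) : holds I (Eqn m (flat t) w [::] [::]) by apply: (derive (ms := ms)).
by rewrite /= /scal big_nil !scale1r => <-; rewrite /qw et unarrK.
Qed.

(** Inserts [x], with [i] and [j] idle strands beside it, between the diagrams [u] below and [v]
    above. Every linear map used later is an instance. *)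
Definition whisk m n d c (u : word) i j (v : word) (x : QHom I d c) : QHom I m n :=
  qcomp (qw (i + (c + j)) n v)
    (qcomp (qtens (qid I i) (qtens x (qid I j))) (qw m (i + (d + j)) u)).

Lemma whisk_linear m n d c u i j v : linear (@whisk m n d c u i j v).
Proof.
move=> a x y.
by rewrite /whisk qtensDl qtensDr qcompDl qcompDr qtensZl qtensZr qcompZl qcompZr.
Qed.
HB.instance Definition _ m n d c u i j v :=
  GRing.isLinear.Build Qq (QHom I d c) (QHom I m n) *:%R
    (@whisk m n d c u i j v) (@whisk_linear m n d c u i j v).

Lemma whisk_qw m n d c u i j v w :
  [&& valid m u, out m u == i + (d + j), valid d w, out d w == c,
      valid (i + (c + j)) v & out (i + (c + j)) v == n]%N ->
  whisk m n u i j v (qw d c w) = qw m n (u ++ shift i w ++ v).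
Proof.
case/and5P=> vu /eqP ou vw /eqP ow /andP[vv /eqP ov].
have iu : (i + d <= out m u)%N by rewrite ou; lia.
have jE : (out m u - (i + d))%N = j by rewrite ou; lia.
rewrite -[LHS]unarrK -!acomp_arr !arr_qw // /qw; congr unarr.
rewrite (ev_context I vu vw iu) ?ow jE //; congr (acomp _ (acomp _ _)).
by rewrite -(arr_qw vw ow) unarrK.
Qed.

End Typed.

(** * Identities between diagrams *)

Local Notation m_ i := (i%N, Merge).
Local Notation p_ i := (i%N, Pos).
Local Notation n_ i := (i%N, Neg).
Local Notation u_ i := (i%N, Cup).
Local Notation a_ i := (i%N, Cap).
Local Notation s_ i := (i%N, Split).

Section Skein.
Variable I : tensor_ideal.
Notation holds := (holds I).
Notation eq0 n l r := (Eqn n l r [::] [::]).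

Definition fw e (h : holds e) := Fw (Law h).
Definition bw e (h : holds e) := Bw (Law h).
Definition ins e (h : holds e) := Ins (Law h).

Lemma zigzag_l : holds (eq0 1 [:: u_ 1; a_ 0] [::]).
Proof. exact: (law_flat I teq_R1l isT). Qed.

Lemma zigzag_r : holds (eq0 1 [:: u_ 0; a_ 1] [::]).
Proof. exact: (law_flat I teq_R1r isT). Qed.

Lemma split_l : holds (eq0 1 [:: u_ 0; m_ 1] [:: s_ 0]).
Proof.
split=> //; congr ascale; have [_ _ e] := flatP I (isT : monomial tsplit).
by apply: etrans e (esym (ev_gen I Split)).
Qed.

Lemma split_r : holds (eq0 1 [:: u_ 1; m_ 0] [:: s_ 0]).
Proof.
have [_ e] := law_flat I teq_R2 isT; have [_ e'] := split_l.
by split=> //; apply: etrans (esym e) e'.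
Qed.

Lemma cap_neg : holds (eq0 3 [:: n_ 0; a_ 1] [:: p_ 1; a_ 0]).
Proof. exact: (law_flat I teq_R3m isT). Qed.

Lemma cap_pos : holds (eq0 3 [:: p_ 0; a_ 1] [:: n_ 1; a_ 0]).
Proof. exact: (law_flat I teq_R3p isT). Qed.

Lemma pos_neg : holds (eq0 2 [:: p_ 0; n_ 0] [::]).
Proof. exact: (law_flat I teq_R4l isT). Qed.

Lemma neg_pos : holds (eq0 2 [:: n_ 0; p_ 0] [::]).
Proof. exact: (law_flat I teq_R4r isT). Qed.

Lemma merge_pos_over : holds (eq0 3 [:: p_ 1; p_ 0; m_ 1] [:: m_ 0; p_ 0]).
Proof. exact: (law_flat I teq_R6 isT). Qed.

Lemma split_pos_under : holds (eq0 2 [:: s_ 1; p_ 0; p_ 1] [:: p_ 0; s_ 0]).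
Proof.
by apply: (derive (ms := [:: bw split_l 0; fw (law_flat I teq_R7 isT) 0; fw split_l 1])).
Qed.

Lemma pos_cap : holds (Eqn 2 [:: p_ 0; a_ 0] [:: a_ 0] [::] [:: Abeta]).
Proof. exact: (law_flat_scale I (a := Abeta) teq_R8cap isT). Qed.

Lemma pos_merge : holds (Eqn 2 [:: p_ 0; m_ 0] [:: m_ 0] [::] [:: Atau]).
Proof. exact: (law_flat_scale I (a := Atau) teq_R8merge isT). Qed.

Lemma bigon : holds (Eqn 1 [:: s_ 0; m_ 0] [::] [::] [:: Aphi]).
Proof.
by apply: (derive (ms := [:: bw split_l 0;
  fw (law_flat_scale I (a := Aphi) teq_R8bigon isT) 0])).
Qed.

Lemma loop : holds (Eqn 0 [:: u_ 0; a_ 0] [::] [::] [:: Adelta]).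
Proof. exact: (law_flat_scale I (a := Adelta) teq_R8loop isT). Qed.

(** No word denotes the zero morphism, so vanishing is expressed as being 0 times some word of the
    same type. *)
Lemma lollipop :
  holds (Eqn 0 [:: u_ 0; m_ 0] [:: u_ 0; m_ 0] [::] [:: Azero]).
Proof.
apply: (law_flat_scale I (f := (tmerge ∘ tcup)%T) (g := (tmerge ∘ tcup)%T)
  (a := Azero) _ isT).
exact: teq_trans teq_R8lollipop (teq_sym (teq_scale0 _)).
Qed.

Lemma split_cap_r : holds (eq0 2 [:: s_ 0; a_ 1] [:: m_ 0]).
Proof.
by apply: (derive (ms := [:: bw split_r 0; SwR 1; fw zigzag_r 0])).
Qed.

Lemma split_cap_l : holds (eq0 2 [:: s_ 1; a_ 0] [:: m_ 0]).
Proof.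
by apply: (derive (ms := [:: bw split_l 0; SwL 1; fw zigzag_l 0])).
Qed.

Lemma merge_cap : holds (eq0 3 [:: m_ 0; a_ 0] [:: m_ 1; a_ 0]).
Proof.
by apply: (derive (ms := [:: bw split_cap_l 0; SwR 1; fw split_cap_r 0])).
Qed.

Lemma cup_split : holds (eq0 0 [:: u_ 0; s_ 0] [:: u_ 0; s_ 1]).
Proof.
by apply: (derive (ms := [:: bw split_l 1; SwL 0; fw split_r 1])).
Qed.

Lemma ladder : holds (eq0 2 [:: s_ 1; m_ 0] [:: s_ 0; m_ 1]).
Proof.
by apply: (derive (ms := [:: bw split_l 0; SwL 1; fw split_r 0])).
Qed.

(** The mate of relation (R3): an inserted zigzag supplies the cap around which the crossing
    turns. *)
Lemma cup_pos : holds (eq0 1 [:: u_ 0; p_ 1] [:: u_ 1; n_ 0]).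
Proof.
by apply: (derive (ms := [:: ins zigzag_l 2 2; SwR 1; SwR 0; fw cap_pos 2; SwR 1;
  fw zigzag_r 2])).
Qed.

Lemma cup_neg : holds (eq0 1 [:: u_ 0; n_ 1] [:: u_ 1; p_ 0]).
Proof.
by apply: (derive (ms := [:: ins zigzag_l 2 2; SwR 1; SwR 0; fw cap_neg 2; SwR 1;
  fw zigzag_r 2])).
Qed.

Lemma neg_cap : holds (Eqn 2 [:: n_ 0; a_ 0] [:: a_ 0] [:: Abeta] [::]).
Proof.
by apply: (derive (ms := [:: bw pos_cap 1; fw neg_pos 0])).
Qed.

Lemma neg_merge : holds (Eqn 2 [:: n_ 0; m_ 0] [:: m_ 0] [:: Atau] [::]).
Proof.
by apply: (derive (ms := [:: bw pos_merge 1; fw neg_pos 0])).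
Qed.

Lemma split_pos_over : holds (eq0 2 [:: s_ 0; p_ 1; p_ 0] [:: p_ 0; s_ 1]).
Proof.
by apply: (derive (ms := [:: bw split_l 0; bw merge_pos_over 1; SwR 0; SwL 3;
  fw cup_pos 1; fw neg_pos 2; fw split_l 1])).
Qed.

Lemma split_neg_under : holds (eq0 2 [:: s_ 1; n_ 0; n_ 1] [:: n_ 0; s_ 0]).
Proof.
by apply: (derive (ms := [:: ins neg_pos 0 0; bw split_pos_over 1; fw pos_neg 3;
  fw pos_neg 2])).
Qed.

Lemma split_neg_over : holds (eq0 2 [:: s_ 0; n_ 1; n_ 0] [:: n_ 0; s_ 1]).
Proof.
by apply: (derive (ms := [:: ins neg_pos 0 0; bw split_pos_under 1; fw pos_neg 3;
  fw pos_neg 2])).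
Qed.

(** With the split drawn as a merge with two cups and a cap, the crossing slides along the cups
    until it meets the two inputs of the merge. *)
Lemma pos_split : holds (Eqn 1 [:: s_ 0; p_ 0] [:: s_ 0] [::] [:: Atau]).
Proof.
by apply: (derive (ms := [:: bw split_l 0; bw split_cap_r 1; SwL 2; bw split_l 1; SwL 2;
  bw cup_neg 1; SwL 0; bw cup_pos 1; fw pos_merge 2; fw split_l 1; fw split_cap_r 1;
  fw split_l 0])).
Qed.

Lemma pos_cup : holds (Eqn 0 [:: u_ 0; p_ 0] [:: u_ 0] [::] [:: Abeta]).
Proof.
by apply: (derive (ms := [:: ins zigzag_l 1 0; SwR 2; fw cup_pos 1; SwR 0; fw cup_neg 1;
  fw pos_cap 2; fw zigzag_l 1])).
Qed.

Definition wcap := [:: a_ 0].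
Definition wmerge := [:: m_ 0].
Definition wU := [:: a_ 0; u_ 0].
Definition wH := [:: s_ 1; m_ 0].
Definition wN := [:: m_ 0; s_ 0].
Definition wp := [:: p_ 0].
Definition wn := [:: n_ 0].
(** Clockwise rotation by one leg of a diagram with two inputs and [k] outputs: the bottom left leg
    is bent up, the top right one down. *)
Definition rot k (w : word) := u_ 0 :: shift 1 w ++ [:: a_ k].

Definition wP := [:: s_ 1; m_ 0; s_ 0; s_ 2; m_ 1].

(* The families [Q], [R] (the paper's [N]) and [X] are indexed by the position of
   the distinguished leg among bottom left, top left, top middle, top right,
   bottom right, so that rotation adds 1: [wQ0, ..., wQ4] are the paper's
   [Q_5, Q_3, Q_1, Q_2, Q_4], and likewise for [R] and [X]. *)
Definition wQ0 := [:: s_ 1; m_ 0; s_ 0].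
Definition wQ1 := [:: m_ 0; s_ 0; s_ 1].
Definition wQ2 := [:: s_ 0; s_ 2; m_ 1].
Definition wQ3 := [:: m_ 0; s_ 0; s_ 0].
Definition wQ4 := [:: s_ 1; m_ 0; s_ 1].

Definition wR0 := [:: m_ 0; u_ 1].
Definition wR1 := [:: s_ 0].
Definition wR2 := [:: a_ 0; u_ 0; s_ 1].
Definition wR3 := [:: s_ 1].
Definition wR4 := [:: u_ 0; m_ 2].

Definition wX0 := [:: n_ 0; s_ 1].
Definition wX1 := [:: s_ 1; p_ 0].
Definition wX2 := [:: u_ 0; m_ 2; p_ 1].
Definition wX3 := [:: s_ 0; n_ 1].
Definition wX4 := [:: p_ 0; s_ 0].

(** * Rotations and closures of the diagrams *)

Lemma rot_id : holds (eq0 2 (rot 2 [::]) wU).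
Proof. by apply: (derive (ms := [:: SwR 0])). Qed.

Lemma rot_U : holds (eq0 2 (rot 2 wU) [::]).
Proof. by apply: (derive (ms := [:: fw zigzag_r 0; fw zigzag_r 0])). Qed.

Lemma rot_H : holds (eq0 2 (rot 2 wH) wN).
Proof. by apply: (derive (ms := [:: SwR 0; fw split_l 1; SwR 1; fw split_cap_r 0])). Qed.

Lemma rot_N : holds (eq0 2 (rot 2 wN) wH).
Proof. by apply: (derive (ms := [:: fw split_l 0; fw split_cap_r 1; bw ladder 0])). Qed.

Lemma rot_pos : holds (eq0 2 (rot 2 wp) wn).
Proof. by apply: (derive (ms := [:: fw cap_pos 1; SwR 0; fw zigzag_r 1])). Qed.

Lemma rot_neg : holds (eq0 2 (rot 2 wn) wp).
Proof. by apply: (derive (ms := [:: fw cap_neg 1; SwR 0; fw zigzag_r 1])). Qed.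

Lemma cap_U : holds (Eqn 2 (wU ++ wcap) wcap [::] [:: Adelta]).
Proof. by apply: (derive (ms := [:: fw loop 1])). Qed.

Lemma cap_H : holds (Eqn 2 (wH ++ wcap) wcap [::] [:: Aphi]).
Proof. by apply: (derive (ms := [:: fw merge_cap 1; fw bigon 0])). Qed.

Lemma merge_N : holds (Eqn 2 (wN ++ wmerge) wmerge [::] [:: Aphi]).
Proof. by apply: (derive (ms := [:: fw bigon 1])). Qed.

Lemma cap_Hpos : holds (Eqn 2 (wH ++ wp ++ wcap) wcap [::] [:: Abeta; Aphi]).
Proof. by apply: (derive (ms := [:: fw pos_cap 2; fw merge_cap 1; fw bigon 0])). Qed.

Lemma merge_Hpos : holds (Eqn 2 (wH ++ wp ++ wmerge) (wH ++ wmerge) [::] [:: Atau]).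
Proof. by apply: (derive (ms := [:: fw pos_merge 2])). Qed.

(** Pulling the crossing through the merge by (R6) leaves one crossing on the split, worth [tau],
    and one on the cup, which turns negative. *)
Lemma rot_Hpos : holds (Eqn 2 (rot 2 (wH ++ wp)) (wH ++ wn) [::] [:: Atau]).
Proof.
by apply: (derive (ms := [:: bw merge_pos_over 2; fw pos_split 1; SwR 0;
  fw cup_pos 1; SwR 2; SwR 3; fw split_l 1; fw split_cap_r 1; bw ladder 0])).
Qed.

Lemma pos_Hneg : holds (eq0 2 (wH ++ wn ++ wp) wH).
Proof. by apply: (derive (ms := [:: fw neg_pos 2])). Qed.

Lemma pos_U : holds (Eqn 2 (wU ++ wp) wU [::] [:: Abeta]).
Proof. by apply: (derive (ms := [:: fw pos_cup 1])). Qed.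

Lemma pos_N : holds (Eqn 2 (wN ++ wp) wN [::] [:: Atau]).
Proof. by apply: (derive (ms := [:: fw pos_split 1])). Qed.

Lemma U_H : holds (Eqn 2 (wH ++ wU) wU [::] [:: Aphi]).
Proof. by apply: (derive (ms := [:: fw merge_cap 1; fw bigon 0])). Qed.

Lemma rot_P : holds (eq0 2 (rot 3 wP) wP).
Proof.
by apply: (derive (ms := [:: SwR 0; SwR 5; fw split_l 1; fw split_cap_r 3; SwR 2;
  SwR 1; bw ladder 0; bw ladder 3])).
Qed.

Lemma rot_Q0 : holds (eq0 2 (rot 3 wQ0) wQ1).
Proof.
by apply: (derive (ms := [:: SwR 0; SwR 3; fw split_l 1; SwR 1;
  fw split_cap_r 0])).
Qed.

Lemma rot_R0 : holds (eq0 2 (rot 3 wR0) wR1).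
Proof. by apply: (derive (ms := [:: fw zigzag_r 2; fw split_l 0])). Qed.

Lemma rot_X0 : holds (eq0 2 (rot 3 wX0) wX1).
Proof.
by apply: (derive (ms := [:: fw split_cap_r 2; fw cup_neg 0; SwR 1;
  fw split_l 0])).
Qed.

Lemma rot_Q1 : holds (eq0 2 (rot 3 wQ1) wQ2).
Proof. by apply: (derive (ms := [:: fw split_l 0; fw split_cap_r 2; bw ladder 1])). Qed.

Lemma rot_R1 : holds (eq0 2 (rot 3 wR1) wR2).
Proof. by apply: (derive (ms := [:: SwR 1; SwR 0])). Qed.

Lemma rot_X1 : holds (eq0 2 (rot 3 wX1) wX2).
Proof. by apply: (derive (ms := [:: SwR 2; fw split_cap_r 1])). Qed.

Lemma rot_Q2 : holds (eq0 2 (rot 3 wQ2) wQ3).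
Proof.
by apply: (derive (ms := [:: SwR 3; fw split_cap_r 2; SwR 1; SwR 0;
  bw cup_split 1; SwR 2; fw split_l 1])).
Qed.

Lemma rot_R2 : holds (eq0 2 (rot 3 wR2) wR3).
Proof. by apply: (derive (ms := [:: fw zigzag_r 0; fw split_cap_r 1; fw split_l 0])). Qed.

Lemma rot_X2 : holds (eq0 2 (rot 3 wX2) wX3).
Proof.
by apply: (derive (ms := [:: SwR 1; fw split_l 0; fw cap_pos 2; SwR 1;
  fw zigzag_r 2])).
Qed.

Lemma rot_Q3 : holds (eq0 2 (rot 3 wQ3) wQ4).
Proof.
by apply: (derive (ms := [:: SwR 3; fw split_l 0; fw split_cap_r 1;
  bw ladder 0])).
Qed.

Lemma rot_R3 : holds (eq0 2 (rot 3 wR3) wR4).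
Proof. by apply: (derive (ms := [:: fw split_cap_r 1])). Qed.

Lemma rot_X3 : holds (eq0 2 (rot 3 wX3) wX4).
Proof.
by apply: (derive (ms := [:: fw cap_neg 2; SwR 1; SwR 0; fw split_cap_r 2;
  fw split_l 1])).
Qed.

Lemma rot_Q4 : holds (eq0 2 (rot 3 wQ4) wQ0).
Proof.
by apply: (derive (ms := [:: SwR 0; fw split_l 1; fw split_cap_r 2; SwR 1;
  bw ladder 0])).
Qed.

Lemma rot_R4 : holds (eq0 2 (rot 3 wR4) wR0).
Proof. by apply: (derive (ms := [:: SwR 1; SwR 2; fw split_l 0; fw split_cap_r 0])). Qed.

Lemma rot_X4 : holds (eq0 2 (rot 3 wX4) wX0).
Proof. by apply: (derive (ms := [:: SwR 2; fw cap_pos 1; SwR 0; fw zigzag_r 1])). Qed.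

(** * Merging the two left outputs *)

Lemma merge_Q0 : holds (Eqn 2 (wQ0 ++ wmerge) wH [::] [:: Aphi]).
Proof. by apply: (derive (ms := [:: fw bigon 2])). Qed.

Lemma merge_Q3 : holds (Eqn 2 (wQ3 ++ wmerge) wN [::] [:: Aphi]).
Proof. by apply: (derive (ms := [:: fw bigon 2])). Qed.

Lemma merge_R0 : holds (eq0 2 (wR0 ++ wmerge) wN).
Proof. by apply: (derive (ms := [:: fw split_r 1])). Qed.

Lemma merge_R1 : holds (Eqn 2 (wR1 ++ wmerge) [::] [::] [:: Aphi]).
Proof. by apply: (derive (ms := [:: fw bigon 0])). Qed.

Lemma merge_R2 : holds (Eqn 2 (wR2 ++ wmerge) wU [::] [:: Aphi]).
Proof. by apply: (derive (ms := [:: bw cup_split 1; fw bigon 2])). Qed.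

(** A negative crossing absorbed by the merge and a positive one absorbed by a split contribute
    inverse factors; symbolic scalars do not cancel, so both stay. *)
Lemma merge_X0 : holds (Eqn 2 (wX0 ++ wmerge) (wH ++ wn) [:: Atau] [:: Atau]).
Proof.
by apply: (derive (ms := [:: bw split_neg_over 0; fw neg_merge 2;
  bw split_cap_l 2; bw split_neg_under 1; SwR 0; SwL 3; bw cap_pos 2; fw pos_split 1;
  fw split_cap_r 1])).
Qed.

Lemma merge_X1 : holds (Eqn 2 (wX1 ++ wmerge) wH [::] [:: Atau]).
Proof. by apply: (derive (ms := [:: fw pos_merge 1])). Qed.

Lemma merge_X2 : holds (Eqn 2 (wX2 ++ wmerge) wN [:: Atau] [::]).
Proof.
by apply: (derive (ms := [:: SwR 0; fw cup_pos 1; fw neg_merge 2;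
  fw split_r 1])).
Qed.

Lemma merge_X3 : holds (Eqn 2 (wX3 ++ wmerge) (wH ++ wn) [::] [:: Atau]).
Proof.
by apply: (derive (ms := [:: bw split_cap_l 2; bw split_neg_under 1; SwR 0;
  SwL 3; bw cap_pos 2; fw pos_split 1; fw split_cap_r 1])).
Qed.

Lemma merge_X4 : holds (Eqn 2 (wX4 ++ wmerge) wp [::] [:: Aphi]).
Proof. by apply: (derive (ms := [:: fw bigon 1])). Qed.

Lemma cap_N : holds (Eqn 2 (wN ++ wcap) [:: m_ 0; u_ 0; m_ 0; a_ 0] [::] [:: Azero]).
Proof. by apply: (derive (ms := [:: bw split_l 1; bw merge_cap 2; fw lollipop 1])). Qed.

Lemma merge_U : holds (Eqn 2 (wU ++ wmerge) (wU ++ wmerge) [::] [:: Azero]).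
Proof. by apply: (derive (ms := [:: fw lollipop 1])). Qed.

Lemma merge_R4 : holds (Eqn 2 (wR4 ++ wmerge) [:: u_ 0; m_ 0; m_ 1] [::] [:: Azero]).
Proof. by apply: (derive (ms := [:: SwL 1; fw lollipop 0])). Qed.

Section Triangle.
(** The triangle is not a defining relation; it is obtained in T/I by [etriE], from the coordinates
    of [s+ H]. *)
Hypothesis triangle : holds (Eqn 2 [:: s_ 1; m_ 0; m_ 0] [:: m_ 0] [::] [:: Atri]).

Lemma N_H : holds (Eqn 2 (wH ++ wN) wN [::] [:: Atri]).
Proof. by apply: (derive (ms := [:: fw triangle 0])). Qed.

Lemma merge_P : holds (Eqn 2 (wP ++ wmerge) (wH ++ wH) [::] [:: Atri]).
Proof. by apply: (derive (ms := [:: SwR 2; bw ladder 3; fw triangle 3])). Qed.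

Lemma merge_Q1 : holds (Eqn 2 (wQ1 ++ wmerge) wN [::] [:: Atri]).
Proof.
by apply: (derive (ms := [:: bw split_r 1; SwR 2; bw cup_split 1; fw triangle 2;
  fw split_r 1])).
Qed.

Lemma merge_Q2 : holds (Eqn 2 (wQ2 ++ wmerge) wH [::] [:: Atri]).
Proof. by apply: (derive (ms := [:: SwR 0; bw ladder 1; fw triangle 1])). Qed.

End Triangle.
End Skein.

(** * Scalars *)

Section Scalars.
Variables (K : fieldType) (x : K).

(* [c4], ..., [c1530] are products of the cyclotomic polynomials whose orders are
   read off the name: [c36 = Phi_3 Phi_6], [c918 = Phi_9 Phi_18]. *)
Definition c4 : K := x ^+ 2 + 1.
Definition c8 : K := x ^+ 4 + 1.
Definition c36 : K := x ^+ 4 + x ^+ 2 + 1.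
Definition c12 : K := x ^+ 4 - x ^+ 2 + 1.
Definition c24 : K := x ^+ 8 - x ^+ 4 + 1.
Definition c918 : K := x ^+ 12 + x ^+ 6 + 1.
Definition c714 : K := x ^+ 12 + x ^+ 10 + x ^+ 8 + x ^+ 6 + x ^+ 4 + x ^+ 2 + 1.
Definition c20 : K := x ^+ 8 - x ^+ 6 + x ^+ 4 - x ^+ 2 + 1.
Definition c40 : K := x ^+ 16 - x ^+ 12 + x ^+ 8 - x ^+ 4 + 1.
Definition c1530 : K := x ^+ 16 - x ^+ 14 + x ^+ 10 - x ^+ 8 + x ^+ 6 - x ^+ 2 + 1.
Definition tau' : K := x ^+ 12.
Definition beta' : K := x ^+ 24.
Definition phi' : K := c714 * c24 / x ^+ 10.
Definition delta' : K := (x ^+ 24 + x ^+ 22 + x ^+ 20 + x ^+ 18 + x ^+ 16 + x ^+ 14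
    + x ^+ 12 + x ^+ 10 + x ^+ 8 + x ^+ 6 + x ^+ 4 + x ^+ 2 + 1)
  * (x ^+ 8 + 1) * (x ^+ 12 - x ^+ 6 + 1) / x ^+ 22.
Definition tri' : K := - (x ^+ 6 + 1 + x ^- 6).
(* [hp5] is the last coordinate of [s+ H] in the basis [1, U, H, N, s+]; the [hn]
   and the [hh] are the coordinates of [s- H] and of [H ^ 2]; [kappa = c = d] in
   the skein relation; [nu] and [chi] are the coefficients of the theorem. *)
Definition hp5 : K := x ^+ 8 / c8.
Definition kappa : K := - ((x ^+ 8 - 1) / (x ^+ 2 * c36)).
Definition hn1 : K := (x ^+ 14 + x ^+ 12 + x ^+ 10 + x ^+ 8 - 1) / (x ^+ 6 * c8 * c36).
Definition hn2 : K := (- x ^+ 14 + x ^+ 6 + x ^+ 4 + x ^+ 2 + 1) / (x ^+ 12 * c8 * c36).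
Definition hn3 : K := - (x ^+ 6 + x ^+ 2 + 1) / (x ^+ 6 * c36).
Definition hn4 : K := - (x ^+ 6 + x ^+ 4 + 1) / (x ^+ 8 * c36).
Definition hn5 : K := (x ^+ 4 * c8)^-1.
Definition hh1 : K := (x ^+ 10 + x ^+ 8 + x ^+ 6 + x ^+ 4 + 1) / (x ^+ 4 * c8 ^+ 2).
Definition hh2 : K := x ^+ 2 * (x ^+ 10 + x ^+ 6 + x ^+ 4 + x ^+ 2 + 1) / c8 ^+ 2.
Definition hh3 : K := c12 * (x ^+ 6 + x ^+ 4 + 2%:R * x ^+ 2 + 1) / (x ^+ 4 * c8).
Definition hh4 : K := c12 * (x ^+ 6 + 2%:R * x ^+ 4 + x ^+ 2 + 1) / (x ^+ 2 * c8).
Definition hh5 : K := - (c36 ^+ 2 * c12) / (x ^+ 2 * c8 ^+ 2).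
Definition golden_arg : K := c4 * (x ^+ 10 + 1) / x ^+ 6.
Definition nu : K := c714 / (c4 ^+ 2 * c8 ^+ 2).
Definition chi : K := x ^+ 2 * c36 ^+ 2 / (c4 ^+ 2 * c8 ^+ 2).

Hypothesis x_neq0 : x != 0.
Hypothesis x_not_root1 : forall n, (0 < n)%N -> x ^+ n - 1 != 0.

(** Cofactor certificates: given [c], the consequence of [L = 0] is a plain identity for [field]. *)
Lemma eq_by_mul (L c a b : K) : L = 0 -> a - b = c * L -> a = b.
Proof. by move=> -> /eqP; rewrite mulr0 subr_eq0 => /eqP. Qed.

Lemma cyclo_neq0 n y z : (0 < n)%N -> y * z = x ^+ n - 1 -> y != 0.
Proof.
by move=> n0 yz; apply: contraNneq (x_not_root1 n0) => y0; rewrite -yz y0 mul0r.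
Qed.

Lemma c4_neq0 : c4 != 0.
Proof. by apply: (@cyclo_neq0 4 _ (x ^+ 2 - 1)) => //; rewrite /c4; ring. Qed.
Lemma c8_neq0 : c8 != 0.
Proof. by apply: (@cyclo_neq0 8 _ (x ^+ 4 - 1)) => //; rewrite /c8; ring. Qed.
Lemma c36_neq0 : c36 != 0.
Proof. by apply: (@cyclo_neq0 6 _ (x ^+ 2 - 1)) => //; rewrite /c36; ring. Qed.
Lemma c12_neq0 : c12 != 0.
Proof. by apply: (@cyclo_neq0 12 _ (c4 * (x ^+ 6 - 1))) => //; rewrite /c12 /c4; ring. Qed.
Lemma c24_neq0 : c24 != 0.
Proof. by apply: (@cyclo_neq0 24 _ (c8 * (x ^+ 12 - 1))) => //; rewrite /c24 /c8; ring. Qed.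
Lemma c918_neq0 : c918 != 0.
Proof. by apply: (@cyclo_neq0 18 _ (x ^+ 6 - 1)) => //; rewrite /c918; ring. Qed.
Lemma c714_neq0 : c714 != 0.
Proof. by apply: (@cyclo_neq0 14 _ (x ^+ 2 - 1)) => //; rewrite /c714; ring. Qed.
Lemma c20_neq0 : c20 != 0.
Proof. by apply: (@cyclo_neq0 20 _ (c4 * (x ^+ 10 - 1))) => //; rewrite /c20 /c4; ring. Qed.
Lemma c40_neq0 : c40 != 0.
Proof. by apply: (@cyclo_neq0 40 _ (c8 * (x ^+ 20 - 1))) => //; rewrite /c40 /c8; ring. Qed.
Lemma c1530_neq0 : c1530 != 0.
Proof.
apply: (@cyclo_neq0 30 _ (c36 * (x ^+ 10 - 1))) => //; rewrite /c1530 /c36; ring.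
Qed.

Ltac cyclo_field :=
  move: c4_neq0 c8_neq0 c36_neq0 c12_neq0 c24_neq0 c918_neq0 c714_neq0 c20_neq0
    c40_neq0 c1530_neq0;
  rewrite /nu /chi /golden_arg /hh1 /hh2 /hh3 /hh4 /hh5 /hn1 /hn2 /hn3 /hn4 /hn5
    /kappa /hp5;
  rewrite /tau' /beta' /phi' /delta' /tri';
  rewrite /c4 /c8 /c36 /c12 /c24 /c918 /c714 /c20 /c40 /c1530; move=> *;
  field; repeat (apply/andP; split); trivial.

Lemma phi_neq0 : phi' != 0.
Proof. by rewrite !mulf_neq0 ?invr_neq0 ?expf_neq0 ?c714_neq0 ?c24_neq0. Qed.

(* [a1, ..., a5] are the coordinates of [s+ H]; the hypotheses compare coordinates
   in [s+ (rotation of s+ H) = tau H]. *)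
Lemma braided_coef : (forall y : K, y ^+ 2 + y + 1 != 0) ->
  forall a1 a2 a3 a4 a5 : K,
  a5 + a4 * a1 = 0 -> a1 * beta' + a4 * a2 = 0 -> a4 * a3 = tau' ->
  a3 * tau' + a4 * a4 = 0 ->
  [/\ a1 = a5 / x ^+ 8, a2 = a5 * x ^+ 8, a3 = - x ^+ 4 & a4 = - x ^+ 8].
Proof.
move=> omega a1 a2 a3 a4 a5 e1 e2 e3 e4.
have xn n : x ^+ n != 0 by rewrite expf_neq0.
have a4E : a4 = - x ^+ 8.
  (* For z = a4 / x^8 the hypotheses give z^3 = -1, and z^3 + 1 is (z + 1)(w^2 + w + 1) with w =
     -z. *)
  have /eqP : (a4 / x ^+ 8 + 1) * ((- (a4 / x ^+ 8)) ^+ 2 + (- (a4 / x ^+ 8)) + 1) = 0.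
    have -> : (a4 / x ^+ 8 + 1) * ((- (a4 / x ^+ 8)) ^+ 2 + (- (a4 / x ^+ 8)) + 1) =
              (a4 ^+ 3 + x ^+ 24) / x ^+ 24 by field.
    have -> : a4 ^+ 3 = a4 * (a3 * tau' + a4 * a4) - tau' * (a4 * a3) by ring.
    by rewrite e4 e3 /tau'; field.
  rewrite mulf_eq0 (negPf (omega _)) orbF addr_eq0 => /eqP a4E.
  by rewrite -[a4](divfK (xn 8)) a4E mulN1r.
have a1E : a1 = a5 / x ^+ 8.
  by apply: (@eq_by_mul _ (- x ^- 8) _ _ e1); rewrite a4E; field.
split=> //.
  by apply: (@eq_by_mul _ (- x ^- 8) _ _ e2); rewrite a4E a1E /beta'; field.
have e3' : a4 * a3 - tau' = 0 by rewrite e3 subrr.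
by apply: (@eq_by_mul _ (- x ^- 8) _ _ e3'); rewrite a4E /tau'; field.
Qed.

Lemma braided_cap_coef a5 :
  a5 / x ^+ 8 + a5 * x ^+ 8 * delta' + - x ^+ 4 * phi' + a5 * beta' = beta' * phi' ->
  a5 = x ^+ 8 / c8.
Proof.
move=> e.
have e' : a5 / x ^+ 8 + a5 * x ^+ 8 * delta' + - x ^+ 4 * phi'
  + a5 * beta' - beta' * phi' = 0.
  by rewrite e subrr.
(* The inverse of the coefficient x^-8 + x^8 delta + beta of [a5]. *)
apply: (@eq_by_mul _ (x ^+ 14 / (c714 * c8 ^+ 2 * c24 * c40)) _ _ e').
by cyclo_field.
Qed.

Lemma triangle_coef :
  hp5 / x ^+ 8 + - x ^+ 8 * phi' + hp5 * tau' = (tau' + x ^+ 4) * tri'.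
Proof. by cyclo_field. Qed.

Lemma tau_x4_neq0 : tau' + x ^+ 4 != 0.
Proof.
have -> : tau' + x ^+ 4 = x ^+ 4 * (x ^+ 8 + 1) by rewrite /tau'; ring.
rewrite mulf_neq0 ?expf_neq0 //.
by apply: (@cyclo_neq0 16 _ (x ^+ 8 - 1)) => //; ring.
Qed.

Lemma kappa_neq0 : kappa != 0.
Proof.
by rewrite oppr_eq0 !mulf_neq0 ?invr_neq0 ?mulf_neq0 ?expf_neq0 ?c36_neq0
  ?x_not_root1.
Qed.

(** The hypotheses are the skein relation closed with a cap and with a merge. Their determinant is a
    product of cyclotomic factors over a power of [x]; Cramer's rule gives [c], and back
    substitution gives [d]. *)
Lemma skein_coef c d :
  beta' - beta'^-1 = c * (1 - delta') + d * phi' ->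
  tau' - tau'^-1 = c + d * (tri' - phi') -> c = kappa /\ d = kappa.
Proof.
move=> e1 e2.
have det : (1 - delta') * (tri' - phi') - phi' =
  (c36 ^+ 4 * c12 * c918 * c20 * c24 * c40) / x ^+ 32.
  by rewrite /delta' /tri' /phi' /c36 /c12 /c918 /c20 /c24 /c40 /c714; field.
have detn : (1 - delta') * (tri' - phi') - phi' != 0.
  by rewrite det !mulf_neq0 ?invr_neq0 ?expf_neq0 ?c36_neq0 ?c12_neq0 ?c918_neq0
    ?c20_neq0 ?c24_neq0 ?c40_neq0.
have cE : c = kappa.
  apply: (mulIf detn).
  have -> : c * ((1 - delta') * (tri' - phi') - phi') =
    (beta' - beta'^-1) * (tri' - phi') - (tau' - tau'^-1) * phi' by rewrite e1 e2; ring.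
  by cyclo_field.
split=> //.
apply: (mulIf phi_neq0).
have -> : d * phi' = (beta' - beta'^-1) - c * (1 - delta') by rewrite e1; ring.
by rewrite cE; cyclo_field.
Qed.

(** Rotating [s+ H] gives [tau s- H]; the [s-] produced by its last coordinate is replaced using the
    skein relation. *)
Lemma neg_coef :
  [/\ hn1 = (hp5 * x ^+ 8 - kappa * hp5) / tau', hn2 = (hp5 / x ^+ 8 + kappa * hp5) / tau',
      hn3 = (- x ^+ 8 - kappa * hp5) / tau', hn4 = (- x ^+ 4 + kappa * hp5) / tau'
    & hn5 = hp5 / tau'].
Proof. by split; cyclo_field. Qed.

(** With [H] placed below it, the skein relation reads [s+ H - s- H = kappa (H - phi U) + kappa (H ^
    2 - tri N)]; these are its coordinates, solved for [H ^ 2]. *)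
Lemma square_coef :
  [/\ hp5 / x ^+ 8 - hn1 = kappa * hh1, hp5 * x ^+ 8 - hn2 + kappa * phi' = kappa * hh2,
      - x ^+ 4 - hn3 - kappa = kappa * hh3, - x ^+ 8 - hn4 + kappa * tri' = kappa * hh4
    & hp5 - hn5 = kappa * hh5].
Proof. by split; cyclo_field. Qed.

(* Eliminates the coefficients [n] and [a], [a'] of the trees. *)
Lemma crossing_step n a a' xa xb xd xe :
  hh1 * a' + phi' * n + hn1 * (xb + tau' * xe) = 0 ->
  hh2 * a + phi' * n + hn2 * (xa + tau' * xd) = 0 ->
  hh5 * a + hn5 * (xa + tau' * xd) + phi' * xe = 0 ->
  hh5 * a' + hn5 * (xb + tau' * xe) + phi' * xa = 0 ->
  golden_arg * (xe - xa) = xb - xd.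
Proof.
move=> e1 e2 e3 e4.
have e : hh5 * (hh1 * a' + phi' * n + hn1 * (xb + tau' * xe)
    - (hh2 * a + phi' * n + hn2 * (xa + tau' * xd)))
  - hh1 * (hh5 * a' + hn5 * (xb + tau' * xe) + phi' * xa)
  + hh2 * (hh5 * a + hn5 * (xa + tau' * xd) + phi' * xe) = 0.
  by rewrite e1 e2 e3 e4 !(mulr0, subrr, addr0).
apply: (@eq_by_mul _ (x ^+ 2 * c8 ^+ 2 / c714) _ _ e).
by cyclo_field.
Qed.

Lemma golden_arg_poly :
  (x ^+ 2 + 1) ^+ 2 * (x ^+ 10 + 1) ^+ 2 + x ^+ 6 * (x ^+ 2 + 1) * (x ^+ 10 + 1)
    - x ^+ 12 != 0 -> golden_arg ^+ 2 + golden_arg - 1 != 0.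
Proof.
apply: contraNneq => e; apply/eqP; rewrite -[RHS](mulr0 (x ^+ 12)) -e.
by cyclo_field.
Qed.

Definition xint n : K := (x ^+ n - x ^- n) / (x - x^-1).

Lemma xintE n : xint n = (x ^+ (n + n) - 1) / (x ^+ n * (x ^+ 2 - 1) / x).
Proof.
have := @x_not_root1 2 isT; have := expf_neq0 n x_neq0; rewrite /xint exprD.
by move: (x ^+ n) => a a0 x2; field; rewrite x_neq0 a0 x2.
Qed.

Lemma phi'E : xint 2 * xint 7 * xint 12 / (xint 4 * xint 6) = phi'.
Proof.
by rewrite !xintE /phi' /c714 /c24 /=; field; rewrite x_neq0 !x_not_root1.
Qed.

Lemma delta'E : xint 3 * xint 8 * xint 13 * xint 18 / (xint 4 * xint 6 * xint 9) = delta'.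
Proof. by rewrite !xintE /delta' /=; field; rewrite x_neq0 !x_not_root1. Qed.

Lemma nuE : xint 7 / xint 4 ^+ 2 = nu.
Proof.
rewrite !xintE /nu /c714 /=; move: c4_neq0 c8_neq0; rewrite /c4 /c8 => c4n c8n.
by field; rewrite x_neq0 c4n c8n !x_not_root1.
Qed.

Lemma chiE : xint 3 ^+ 2 / xint 4 ^+ 2 = chi.
Proof.
rewrite !xintE /chi /c36 /=; move: c4_neq0 c8_neq0; rewrite /c4 /c8 => c4n c8n.
by field; rewrite x_neq0 c4n c8n !x_not_root1.
Qed.

Hypothesis golden : golden_arg ^+ 2 + golden_arg - 1 != 0.

(** On the powers of a primitive fifth root of unity w the recursion reads golden_arg (w^4 - 1) = w
    - w^3, that is golden_arg = w^2 + w^3. The combination below is the corresponding elimination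
    inside [K]. *)
Lemma crossing_eq x0 x1 x2 x3 x4 :
  golden_arg * (x4 - x0) = x1 - x3 -> golden_arg * (x0 - x1) = x2 - x4 ->
  golden_arg * (x3 - x4) = x0 - x2 ->
  x0 = x4.
Proof.
move=> e0 e1 e4; apply/eqP; rewrite -subr_eq0; apply/eqP/(mulfI golden); rewrite mulr0.
have -> : (golden_arg ^+ 2 + golden_arg - 1) * (x0 - x4) =
  - golden_arg * (golden_arg * (x4 - x0) - (x1 - x3)) + (golden_arg * (x0 - x1) - (x2 - x4))
  + (golden_arg * (x3 - x4) - (x0 - x2)) by ring.
by rewrite e0 e1 e4 !subrr mulr0 !addr0.
Qed.

Lemma symmetric_kernel p a n y :
  hh1 * (a + p * tri') + phi' * n + hn1 * (y + tau' * y) = 0 ->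
  hh5 * (a + p * tri') + hn5 * (y + tau' * y) + phi' * y = 0 ->
  hh3 * (a + p * tri') + phi' * a + tri' * a + n + hn3 * (y + tau' * y) + tau' * y = 0 ->
  [/\ a = p, n = nu * p & y = - chi * p].
Proof.
move=> e1 e5 e3.
set e1L := LHS in e1; set e5L := LHS in e5; set e3L := LHS in e3.
(* [s5] is the coefficient of [y] in [e5]. The combination [e] cancels [n], then [y], and equals
   phi' s5 h (a - p). *)
set s5 := c4 ^+ 2 * c8 * c12 * c24 / x ^+ 10.
set h := c4 ^+ 2 * c918 * c1530 / (x ^+ 10 * c8 * c24).
have e : s5 * (phi' * e3L - e1L)
  - (phi' * hn3 * (1 + tau') + phi' * tau' - hn1 * (1 + tau')) * e5L = 0.
  by rewrite e1 e5 e3 !(mulr0, subrr).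
have aE : a = p.
  apply: (@eq_by_mul _ (phi' * s5 * h)^-1 _ _ e); rewrite /e1L /e3L /e5L /s5 /h.
  by cyclo_field.
have yE : y = - chi * p.
  apply: (@eq_by_mul _ s5^-1 _ _ e5); rewrite /e5L aE /s5.
  by cyclo_field.
split=> //; apply: (@eq_by_mul _ phi'^-1 _ _ e1); rewrite /e1L aE yE.
by cyclo_field.
Qed.

Lemma hh5_neq0 : hh5 != 0.
Proof.
by rewrite /hh5 !mulf_neq0 ?oppr_eq0 ?invr_neq0 ?mulf_neq0 ?expf_neq0
  ?c36_neq0 ?c12_neq0 ?c8_neq0.
Qed.

(** Constancy spreads from the crossings [y] to the trees [a] through the last equation, as [hh5] is
    nonzero, and then to [n] through the first. *)
Lemma merge_kernel p (a n y : nat -> K) :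
  (forall r, [/\ a (r + 5)%N = a r, n (r + 5)%N = n r & y (r + 5)%N = y r]) ->
  (forall r, [/\
    hh1 * (a (r + 4)%N + p * tri') + phi' * n (r + 1)%N
      + hn1 * (y r + tau' * y (r + 3)%N) = 0,
    hh2 * (a (r + 4)%N + p * tri') + phi' * n (r + 2)%N
      + hn2 * (y r + tau' * y (r + 3)%N) = 0,
    hh3 * (a (r + 4)%N + p * tri') + phi' * a r + tri' * a (r + 2)%N + n (r + 3)%N
      + hn3 * (y r + tau' * y (r + 3)%N) + tau' * y (r + 1)%N = 0
  & hh5 * (a (r + 4)%N + p * tri') + hn5 * (y r + tau' * y (r + 3)%N)
      + phi' * y (r + 4)%N = 0]) ->
  forall r, [/\ a r = p, n r = nu * p & y r = - chi * p].
Proof.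
move=> per E.
have ya r k l : (k = l + 5)%N -> y (r + k)%N = y (r + l)%N.
  by move->; rewrite addnA; have [] := per (r + l)%N.
have step r : golden_arg * (y (r + 4)%N - y r) = y (r + 1)%N - y (r + 3)%N.
  have [_ e2 _ e3] := E r; have [e1 _ _ e4] := E (r + 1)%N.
  rewrite -!addnA in e1 e4; rewrite (ya r (1 + 4)%N 0%N) // addn0 in e4.
  exact: crossing_step e1 e2 e3 e4.
have y4 r : y r = y (r + 4)%N.
  have e1 := step (r + 1)%N; have e4 := step (r + 4)%N.
  rewrite -!addnA (ya r (1 + 4)%N 0%N) // addn0 in e1.
  rewrite -!addnA (ya r (4 + 4)%N 3%N) // (ya r (4 + 1)%N 0%N) // in e4.
  rewrite (ya r (4 + 3)%N 2%N) // addn0 in e4.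
  exact: crossing_eq (step r) e1 e4.
(* Modulo 5 a step of 4 is a step of -1. *)
have const (f : nat -> K) : (forall r, f (r + 5)%N = f r) ->
    (forall r, f r = f (r + 4)%N) -> forall r, f r = f 0%N.
  by move=> f5 f4; elim=> // r <-; rewrite f4 -[RHS]f5; congr f; lia.
have yc : forall r, y r = y 0%N by apply: const y4 => r; have [] := per r.
have ac : forall r, a r = a 0%N.
  apply: const => r; first by have [] := per r.
  have [_ _ _ e] := E (r + 1)%N; have [_ _ _ e'] := E r.
  rewrite !yc in e e'.
  apply: (addIr (p * tri')); apply: (mulfI hh5_neq0).
  have d := congr2 (fun u v => u - v) e e'; rewrite /= subrr in d.
  rewrite -addnA in d; have [a5 _ _] := per r; rewrite a5 in d.
  by apply: (@eq_by_mul _ 1 _ _ d); ring.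
have nc r : n r.+1 = n 1%N.
  have [e _ _ _] := E r; have [e' _ _ _] := E 0%N.
  rewrite !(ac (_ + 4)%N) !yc addn1 in e e'; apply: (mulfI phi_neq0).
  have d := congr2 (fun u v => u - v) e e'; rewrite /= subrr in d.
  by apply: (@eq_by_mul _ 1 _ _ d); ring.
have nc' r : n r = n 1%N by have [_ <- _] := per r; rewrite addnS nc.
have [e1 _ e3 e5] := E 0%N.
rewrite !ac !yc !(nc' (_ + _)%N) in e1 e3 e5.
have [aE nE yE] := symmetric_kernel e1 e5 e3.
by move=> r; rewrite ac yc nc' aE nE yE.
Qed.
End Scalars.

(** * Arithmetic of the field of rational functions *)

Import Num.Theory Order.TTheory.

Lemma qpoly_neq0 (p : {poly rat}) x : p.[x] != 0 -> FracField.tofrac p != 0.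
Proof. by apply: contraNneq => /eqP; rewrite tofrac_eq0 => /eqP->; rewrite horner0. Qed.

Lemma q_neq0 : q != 0.
Proof. by apply: (@qpoly_neq0 _ 1); rewrite hornerX oner_neq0. Qed.

Lemma qX_neq1 n : (0 < n)%N -> q ^+ n - 1 != 0.
Proof.
move=> n0; have -> : q ^+ n - 1 = FracField.tofrac ('X^n - 1) by rewrite /q !rmorphE.
by apply: (@qpoly_neq0 _ 0); rewrite !hornerE expr0n; case: n n0.
Qed.

Lemma frac_ratio (R : idomainType) (y : {fraction R}) :
  exists n d : R, d != 0 /\ FracField.tofrac d * y = FracField.tofrac n.
Proof.
elim/quotW: y => r; exists (frac r).1, (frac r).2; split; first exact: denom_ratioP.
unlock FracField.tofrac; rewrite -[LHS]FracField.pi_mul; apply/eqmodP.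
by rewrite /= FracField.equivfE /FracField.mulf !numden_Ratio ?mul1r ?oner_neq0
  ?denom_ratioP // mulr1 mulrC.
Qed.

Lemma poly_nonroot (p : {poly rat}) : p != 0 -> exists x, p.[x] != 0.
Proof.
move=> p0; pose rs : seq rat := [seq k%:R | k <- iota 0 (size p)].
have urs : uniq rs.
  by rewrite map_inj_uniq ?iota_uniq //; apply: Num.Theory.mulrIn; rewrite oner_neq0.
have [ars|] := boolP (all (root p) rs).
  by have := max_poly_roots p0 ars urs; rewrite size_map size_iota ltnn.
by case/allPn => x _ px; exists x.
Qed.

(* A fraction equal to a primitive cube root of unity could be evaluated at a
   rational number, where [y ^+ 2 + y + 1] is positive. *)
Lemma no_cube_root1 (y : Qq) : y ^+ 2 + y + 1 != 0.
Proof.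
have [n [d [d0 yE]]] := frac_ratio y; apply/eqP => y0.
have [x dx] := poly_nonroot d0.
have : n ^+ 2 + n * d + d ^+ 2 == 0.
  rewrite -tofrac_eq0 !(tofracD, tofracM, tofracXn) -yE
    -[X in _ == X](mulr0 (FracField.tofrac d ^+ 2)) -y0.
  by apply/eqP; ring.
move=> /eqP /(congr1 (horner^~ x)); rewrite !hornerE.
move: (n.[x]) (d.[x]) dx => u v v0 e.
have : 0 < (2%:R * u + v) ^+ 2 + 3%:R * v ^+ 2.
  by apply: ltr_wpDl; rewrite ?sqr_ge0 // mulr_gt0 // exprn_even_gt0.
have -> : (2%:R * u + v) ^+ 2 + 3%:R * v ^+ 2 = 4%:R * (u ^+ 2 + u * v + v ^+ 2) by ring.
by rewrite e mulr0 ltxx.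
Qed.

Lemma phiE : phi = phi' q.
Proof. exact: phi'E q_neq0 qX_neq1. Qed.

Lemma deltaE : delta = delta' q.
Proof. exact: delta'E q_neq0 qX_neq1. Qed.

Lemma golden : golden_arg q ^+ 2 + golden_arg q - 1 != 0.
Proof.
apply: (golden_arg_poly q_neq0 qX_neq1).
rewrite (_ : _ - _ = FracField.tofrac
  (('X^2 + 1) ^+ 2 * ('X^10 + 1) ^+ 2 + 'X^6 * ('X^2 + 1) * ('X^10 + 1) - 'X^12)).
  (* The polynomial takes the value 1 at 0. *)
  by apply: (@qpoly_neq0 _ 0); rewrite !hornerE.
by rewrite /q !(tofracB, tofracD, tofracM, tofracXn, tofrac1).
Qed.

Lemma tauE : tau = tau' q. Proof. by rewrite /tau'. Qed.
Lemma betaE : beta = beta' q. Proof. by rewrite /beta'. Qed.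
Lemma triE : tri = tri' q. Proof. by []. Qed.
Lemma tau_neq0 : tau != 0. Proof. exact: expf_neq0 q_neq0. Qed.
Lemma beta_neq0 : beta != 0. Proof. exact: expf_neq0 q_neq0. Qed.

Opaque qw whisk tau beta phi delta tri.

(** * Morphisms from two to two strands *)

Section FourPoint.
Variable I : tensor_ideal.
Hypothesis basis22 : is_basis [tuple qmor I (tid 2); qmor I tU; qmor I tH;
  qmor I tN; qmor I (tadd tsigp tsigm)].

Notation V := (QHom I 2 2).
Notation e1 := (qw I 2 2 [::]).
Notation eU := (qw I 2 2 wU).
Notation eH := (qw I 2 2 wH).
Notation eN := (qw I 2 2 wN).
Notation ep := (qw I 2 2 wp).
Notation en := (qw I 2 2 wn).
Notation eHp := (qw I 2 2 (wH ++ wp)).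
Notation eHn := (qw I 2 2 (wH ++ wn)).
Notation eHH := (qw I 2 2 (wH ++ wH)).

Lemma qmor_basis : [/\ qmor I (tid 2) = e1, qmor I tU = eU, qmor I tH = eH,
  qmor I tN = eN & qmor I (tadd tsigp tsigm) = ep + en].
Proof.
split.
- exact: (qmor_qw (ms := [::])).
- exact: (qmor_qw (ms := [::])).
- exact: (qmor_qw (ms := [:: fw (split_l I) 0])).
- exact: (qmor_qw (ms := [:: fw (split_l I) 1])).
by rewrite qmorD; congr (_ + _); exact: (qmor_qw (ms := [::])).
Qed.

(** The fifth vector is left open: [ep + en] gives the assumed basis, which rotation permutes, and
    [ep] the basis in which crossings are computed. *)
Definition comb (e5 : V) (a b c d e : Qq) : V :=
  a *: e1 + b *: eU + c *: eH + d *: eN + e *: e5.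

Lemma combD v a b c d e a' b' c' d' e' :
  comb v a b c d e + comb v a' b' c' d' e' =
  comb v (a + a') (b + b') (c + c') (d + d') (e + e').
Proof.
rewrite /comb !scalerDl.
by rewrite (AC (5*5) ((1*6)*(2*7)*(3*8)*(4*9)*(5*10))).
Qed.

Lemma combZ v x a b c d e :
  x *: comb v a b c d e = comb v (x * a) (x * b) (x * c) (x * d) (x * e).
Proof. by rewrite /comb !scalerDr !scalerA. Qed.

Lemma combB v a b c d e a' b' c' d' e' :
  comb v a b c d e - comb v a' b' c' d' e' =
  comb v (a - a') (b - b') (c - c') (d - d') (e - e').
Proof. by rewrite -scaleN1r combZ combD !mulN1r. Qed.

Lemma comb_free v a b c d e :
  (forall a b c d e, comb v a b c d e = 0 -> [/\ a = 0, b = 0, c = 0, d = 0 & e = 0]) ->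
  forall a' b' c' d' e', comb v a b c d e = comb v a' b' c' d' e' ->
  [/\ a = a', b = b', c = c', d = d' & e = e'].
Proof.
move=> free a' b' c' d' e' /eqP; rewrite -subr_eq0 combB => /eqP /free[].
by do 5!move=> /subr0_eq ->.
Qed.

Lemma S_free a b c d e : comb (ep + en) a b c d e = 0 ->
  [/\ a = 0, b = 0, c = 0, d = 0 & e = 0].
Proof.
have [indep _] := basis22; have [E1 E2 E3 E4 E5] := qmor_basis.
move=> s0; have := indep (fun i => nth 0 [:: a; b; c; d; e] i).
rewrite !big_ord_recl big_ord0 !(tnth_nth 0) /= E1 E2 E3 E4 E5 addr0 !addrA => /(_ s0) H.
by have := (H 0, H 1, H 2%:R, H 3%:R, H 4%:R) => -[[[[/= -> ->] ->] ->] ->].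
Qed.

Lemma S_span v : exists a b c d e, v = comb (ep + en) a b c d e.
Proof.
have [_ span] := basis22; have [E1 E2 E3 E4 E5] := qmor_basis.
have [c ->] := span v.
rewrite !big_ord_recl big_ord0 !(tnth_nth 0) /= E1 E2 E3 E4 E5 addr0 !addrA.
by do 5!eexists.
Qed.

Lemma law1 n k l r : holds I (Eqn n l r [::] [::]) -> qw I n k l = qw I n k r.
Proof. by move/(qw_law k); rewrite /= /scal big_nil !scale1r. Qed.

Lemma lawr n k l r a : holds I (Eqn n l r [::] [:: a]) ->
  qw I n k l = atom_val a *: qw I n k r.
Proof. by move/(qw_law k); rewrite /= /scal big_nil big_seq1 scale1r. Qed.

Lemma lawl n k l r a : holds I (Eqn n l r [:: a] [::]) ->
  atom_val a *: qw I n k l = qw I n k r.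
Proof. by move/(qw_law k); rewrite /= /scal big_nil big_seq1 scale1r. Qed.

Definition rotate2 : {linear V -> V} :=
  GRing.Linear.clone _ _ _ _ (@whisk I 2 2 2 2 [:: (0%N, Cup)] 1 1 [:: (2%N, Cap)]) _.
Definition cap_top : {linear V -> QHom I 2 0} :=
  GRing.Linear.clone _ _ _ _ (@whisk I 2 0 2 2 [::] 0 0 wcap) _.
Definition merge_top : {linear V -> QHom I 2 1} :=
  GRing.Linear.clone _ _ _ _ (@whisk I 2 1 2 2 [::] 0 0 wmerge) _.
Definition pos_top : {linear V -> V} :=
  GRing.Linear.clone _ _ _ _ (@whisk I 2 2 2 2 [::] 0 0 wp) _.
Definition H_bottom : {linear V -> V} :=
  GRing.Linear.clone _ _ _ _ (@whisk I 2 2 2 2 wH 0 0 [::]) _.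

Lemma linear_comb (W : lmodType Qq) (f : {linear V -> W}) v a b c d e :
  f (comb v a b c d e) = a *: f e1 + b *: f eU + c *: f eH + d *: f eN + e *: f v.
Proof. by rewrite /comb !linearD !linearZ. Qed.

Definition endo w := valid 2 w && (out 2 w == 2).

Lemma rotate2_qw w : endo w -> rotate2 (qw I 2 2 w) = qw I 2 2 (rot 2 w).
Proof. by case/andP=> v o; apply: whisk_qw; rewrite v o. Qed.

Lemma cap_top_qw w : endo w -> cap_top (qw I 2 2 w) = qw I 2 0 (w ++ wcap).
Proof. by case/andP=> v o; rewrite -{2}[w]shift0; apply: whisk_qw; rewrite v o. Qed.

Lemma merge_top_qw w : endo w -> merge_top (qw I 2 2 w) = qw I 2 1 (w ++ wmerge).
Proof. by case/andP=> v o; rewrite -{2}[w]shift0; apply: whisk_qw; rewrite v o. Qed.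

Lemma pos_top_qw w : endo w -> pos_top (qw I 2 2 w) = qw I 2 2 (w ++ wp).
Proof. by case/andP=> v o; rewrite -{2}[w]shift0; apply: whisk_qw; rewrite v o. Qed.

Lemma H_bottom_qw w : endo w -> H_bottom (qw I 2 2 w) = qw I 2 2 (wH ++ w).
Proof.
case/andP=> v o; rewrite -{2}[w]shift0 -[shift 0 w]cats0.
by apply: whisk_qw; rewrite v o.
Qed.

Notation ecap := (qw I 2 0 wcap).
Notation emer := (qw I 2 1 wmerge).
Notation etri := (qw I 2 1 (wH ++ wmerge)).

Lemma rotate2E : [/\ rotate2 e1 = eU, rotate2 eU = e1, rotate2 eH = eN, rotate2 eN = eH &
  [/\ rotate2 ep = en, rotate2 en = ep & rotate2 eHp = tau *: eHn]].
Proof.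
split; [..|split]; (rewrite rotate2_qw; last by []).
- exact: law1 (rot_id I).
- exact: law1 (rot_U I).
- exact: law1 (rot_H I).
- exact: law1 (rot_N I).
- exact: law1 (rot_pos I).
- exact: law1 (rot_neg I).
- exact: (lawr (a := Atau) _ (rot_Hpos I)).
Qed.

Lemma cap_topE : [/\ cap_top e1 = ecap, cap_top eU = delta *: ecap,
  cap_top eH = phi *: ecap, cap_top eN = 0 &
  [/\ cap_top ep = beta *: ecap, beta *: cap_top en = ecap &
    cap_top eHp = (beta * phi) *: ecap]].
Proof.
split; [..|split]; (rewrite cap_top_qw; last by []).
- exact: erefl.
- exact: (lawr (a := Adelta) _ (cap_U I)).
- exact: (lawr (a := Aphi) _ (cap_H I)).
- by rewrite (lawr 0 (cap_N I)) scale0r.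
- exact: (lawr (a := Abeta) _ (pos_cap I)).
- exact: (lawl (a := Abeta) _ (neg_cap I)).
- have := qw_law 0 (cap_Hpos I).
  rewrite /scal big_nil big_cons big_seq1 scale1r; exact.
Qed.

Lemma merge_topE : [/\ merge_top e1 = emer, merge_top eU = 0, merge_top eH = etri,
  merge_top eN = phi *: emer & [/\ merge_top ep = tau *: emer,
    tau *: merge_top en = emer & merge_top eHp = tau *: etri]].
Proof.
split; [..|split]; (rewrite merge_top_qw; last by []).
- exact: erefl.
- by rewrite (lawr 1 (merge_U I)) scale0r.
- exact: erefl.
- exact: (lawr (a := Aphi) _ (merge_N I)).
- exact: (lawr (a := Atau) _ (pos_merge I)).
- exact: (lawl (a := Atau) _ (neg_merge I)).
- exact: (lawr (a := Atau) _ (merge_Hpos I)).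
Qed.

Lemma pos_topE : [/\ pos_top e1 = ep, pos_top eU = beta *: eU, pos_top eH = eHp,
  pos_top eN = tau *: eN & pos_top en = e1 /\ pos_top eHn = eH].
Proof.
split; [..|split]; (rewrite pos_top_qw; last by []).
- exact: erefl.
- exact: (lawr (a := Abeta) _ (pos_U I)).
- exact: erefl.
- exact: (lawr (a := Atau) _ (pos_N I)).
- exact: law1 (neg_pos I).
- exact: law1 (pos_Hneg I).
Qed.

Lemma skein : exists c d : Qq, ep - en = c *: (e1 - eU) + d *: (eH - eN).
Proof.
have [R1 RU RH RN [Rp Rn _]] := rotate2E.
have [a [b [c [d [e]]]]] := S_span ep.
have : rotate2 (ep + en) = ep + en by rewrite linearD Rp Rn addrC.
set v := ep + en => Rv epE.
have enE : en = comb v b a d c e.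
  by rewrite -Rp epE linear_comb R1 RU RH RN Rv /comb (AC 5 (2*1*4*3*5)).
have sE : v = comb v 0 0 0 0 1 by rewrite /comb !scale0r !add0r scale1r.
have [ab _ cd _ _] : [/\ 0 = a + b :> Qq, 0 = b + a :> Qq, 0 = c + d :> Qq,
    0 = d + c :> Qq & 1 = e + e :> Qq].
  apply: comb_free; first by move=> ? ? ? ? ?; exact: S_free.
  by rewrite -combD -epE -enE -sE.
(* The sum [v] has coordinates 0, 0, 0, 0, 1, so b = -a and d = -c, and the difference has
   coordinates 2a, -2a, 2c, -2c, 0. *)
exists (a + a), (c + c).
rewrite {1}epE {1}enE combB.
have -> : b = - a by apply/eqP; rewrite -addr_eq0 addrC -ab.
have -> : d = - c by apply/eqP; rewrite -addr_eq0 addrC -cd.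
rewrite /comb subrr scale0r addr0 !opprK !scalerBr -!addrA; congr (_ + _).
by rewrite -scaleNr opprD; congr (_ + (_ + _)); rewrite -scaleNr opprD.
Qed.

(** The basis vector [U] factors through the cap; likewise [N] through the merge in [emer_neq0]. *)
Lemma ecap_neq0 : ecap != 0.
Proof.
apply/eqP => k0.
have u0 : eU = 0.
  transitivity (@whisk I 2 2 2 0 [::] 0 0 [:: (0%N, Cup)] ecap).
    by rewrite whisk_qw.
  by rewrite k0 linear0.
have [_ /eqP] : [/\ 0 = 0 :> Qq, 1 = 0 :> Qq, 0 = 0 :> Qq, 0 = 0 :> Qq & 0 = 0 :> Qq].
  by apply: S_free; rewrite /comb u0 !scale0r scaler0 !addr0.
by rewrite oner_eq0.
Qed.

Lemma emer_neq0 : emer != 0.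
Proof.
apply/eqP => k0.
have u0 : eN = 0.
  transitivity (@whisk I 2 2 2 1 [::] 0 0 [:: (0%N, Split)] emer).
    by rewrite whisk_qw.
  by rewrite k0 linear0.
have [_ _ _ /eqP] : [/\ 0 = 0 :> Qq, 0 = 0 :> Qq, 0 = 0 :> Qq, 1 = 0 :> Qq & 0 = 0 :> Qq].
  by apply: S_free; rewrite /comb u0 !scale0r scaler0 !addr0.
by rewrite oner_eq0.
Qed.

Lemma scalar_inj (W : lmodType Qq) (v : W) (a b : Qq) :
  v != 0 -> a *: v = b *: v -> a = b.
Proof.
by move=> v0 /eqP; rewrite -subr_eq0 -scalerBl scaler_eq0 (negPf v0) orbF subr_eq0 => /eqP.
Qed.

Lemma two_neq0 : 2%:R != 0 :> Qq.
Proof.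
have -> : 2%:R = FracField.tofrac (2%:R : {poly rat}) :> Qq by rewrite rmorph_nat.
by apply: (@qpoly_neq0 _ 0); rewrite -polyC_natr hornerC.
Qed.

Definition vec := comb ep.

Lemma vecD a b c d e a' b' c' d' e' :
  vec a b c d e + vec a' b' c' d' e' = vec (a + a') (b + b') (c + c') (d + d') (e + e').
Proof. exact: combD. Qed.

Lemma vecZ x a b c d e :
  x *: vec a b c d e = vec (x * a) (x * b) (x * c) (x * d) (x * e).
Proof. exact: combZ. Qed.

Lemma vecB a b c d e a' b' c' d' e' :
  vec a b c d e - vec a' b' c' d' e' = vec (a - a') (b - b') (c - c') (d - d') (e - e').
Proof. exact: combB. Qed.

Lemma linear_vec (W : lmodType Qq) (f : {linear V -> W}) a b c d e :
  f (vec a b c d e) = a *: f e1 + b *: f eU + c *: f eH + d *: f eN + e *: f ep.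
Proof. exact: linear_comb. Qed.

Lemma e1_vec : e1 = vec 1 0 0 0 0.
Proof. by rewrite /vec /comb !scale0r !addr0 scale1r. Qed.
Lemma eU_vec : eU = vec 0 1 0 0 0.
Proof. by rewrite /vec /comb !scale0r !addr0 scale1r add0r. Qed.
Lemma eH_vec : eH = vec 0 0 1 0 0.
Proof. by rewrite /vec /comb !scale0r !addr0 scale1r !add0r. Qed.
Lemma eN_vec : eN = vec 0 0 0 1 0.
Proof. by rewrite /vec /comb !scale0r !addr0 scale1r !add0r. Qed.
Lemma ep_vec : ep = vec 0 0 0 0 1.
Proof. by rewrite /vec /comb !scale0r !add0r scale1r. Qed.

(** * Coordinates in the basis with the positive crossing *)

Section SkeinCoefficients.
Variables c d : Qq.
Hypothesis skein_cd : ep - en = c *: (e1 - eU) + d *: (eH - eN).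

Lemma en_vec : en = vec (- c) c (- d) d 1.
Proof.
have dE : ep - en = vec c (- c) d (- d) 0.
  by rewrite skein_cd /vec /comb !scalerBr !scaleNr scale0r addr0 addrA.
rewrite -[LHS](subKr ep) dE {1}ep_vec vecB.
by congr (vec _ _ _ _ _); rewrite ?sub0r ?opprK ?subr0.
Qed.

Lemma S_vec x1 x2 x3 x4 x5 : comb (ep + en) x1 x2 x3 x4 x5 =
  vec (x1 - x5 * c) (x2 + x5 * c) (x3 - x5 * d) (x4 + x5 * d) (x5 * 2%:R).
Proof.
rewrite {1}/comb scalerDr addrA -/(comb ep _ _ _ _ _) -/(vec _ _ _ _ _) en_vec vecZ vecD.
by congr (vec _ _ _ _ _); ring.
Qed.

(** By the skein relation [ep + en] is twice [ep] up to the other basis vectors, whence the division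
    by 2. *)
Lemma vec_S x1 x2 x3 x4 x5 : vec x1 x2 x3 x4 x5 =
  comb (ep + en) (x1 + x5 / 2%:R * c) (x2 - x5 / 2%:R * c) (x3 + x5 / 2%:R * d)
    (x4 - x5 / 2%:R * d) (x5 / 2%:R).
Proof. by rewrite S_vec !addrK !subrK divfK ?two_neq0. Qed.

Lemma vec_free x1 x2 x3 x4 x5 : vec x1 x2 x3 x4 x5 = 0 ->
  [/\ x1 = 0, x2 = 0, x3 = 0, x4 = 0 & x5 = 0].
Proof.
rewrite vec_S => /S_free[+ + + + x0].
rewrite x0 !mul0r !addr0 !subr0 => -> -> -> ->; split=> //.
by apply: (mulIf (invr_neq0 two_neq0)); rewrite x0 mul0r.
Qed.

Lemma vec_inj x1 x2 x3 x4 x5 y1 y2 y3 y4 y5 :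
  vec x1 x2 x3 x4 x5 = vec y1 y2 y3 y4 y5 ->
  [/\ x1 = y1, x2 = y2, x3 = y3, x4 = y4 & x5 = y5].
Proof. exact: comb_free vec_free _ _ _ _ _. Qed.

Lemma vec_span v : exists x1 x2 x3 x4 x5, v = vec x1 x2 x3 x4 x5.
Proof. by have [a [b [c' [d' [e ->]]]]] := S_span v; rewrite S_vec; do 5!eexists. Qed.

Lemma eHp_coef : exists a5, eHp = vec (a5 / q ^+ 8) (a5 * q ^+ 8) (- q ^+ 4) (- q ^+ 8) a5.
Proof.
have [a1 [a2 [a3 [a4 [a5 eHpE]]]]] := vec_span eHp.
have [R1 RU RH RN [Rp _ RHp]] := rotate2E; have [P1 PU PH PN [Pn PHn]] := pos_topE.
have e : pos_top (rotate2 eHp) = vec 0 0 tau 0 0.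
  by rewrite RHp linearZZ PHn eH_vec vecZ !mulr0 mulr1.
(* Rotation turns the [N] of [s+ H] into [H], and [s+] turns it back into [s+ H]: the unknown
   coordinates reappear with factor [a4], so the system is quadratic. *)
have : vec (a5 + a4 * a1) (a1 * beta + a4 * a2) (a4 * a3) (a3 * tau + a4 * a4)
    (a2 + a4 * a5) = vec 0 0 tau 0 0.
  rewrite -e {1}eHpE linear_vec R1 RU RH RN Rp !linearD !linearZZ P1 PU PH PN Pn.
  rewrite eHpE e1_vec eU_vec eN_vec ep_vec !vecZ !vecD.
  by congr (vec _ _ _ _ _); ring.
case/vec_inj => h1 h2 h3 h4 _; exists a5; rewrite {1}eHpE.
rewrite tauE betaE in h2 h3 h4.
by have [-> -> -> ->] := braided_coef q_neq0 no_cube_root1 h1 h2 h3 h4.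
Qed.

Lemma eHp_vec : eHp = vec (hp5 q / q ^+ 8) (hp5 q * q ^+ 8) (- q ^+ 4) (- q ^+ 8) (hp5 q).
Proof.
have [a5 eHpE] := eHp_coef.
have [C1 CU CH CN [Cp _ CHp]] := cap_topE.
have : cap_top eHp =
    (a5 / q ^+ 8 + a5 * q ^+ 8 * delta + - q ^+ 4 * phi + a5 * beta) *: ecap.
  by rewrite eHpE linear_vec C1 CU CH CN Cp scaler0 addr0 !scalerA -!scalerDl.
rewrite CHp => /(scalar_inj ecap_neq0) /esym; rewrite deltaE phiE betaE => e.
by rewrite eHpE (braided_cap_coef q_neq0 qX_neq1 e).
Qed.

Lemma etriE : etri = tri *: emer.
Proof.
have [M1 MU MH MN [Mp _ MHp]] := merge_topE.
have : tau *: etri =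
    (hp5 q / q ^+ 8 + - q ^+ 8 * phi + hp5 q * tau) *: emer - q ^+ 4 *: etri.
  rewrite -MHp eHp_vec linear_vec M1 MU MH MN Mp scaler0 addr0 !scalerA !scalerDl scaleNr.
  by rewrite (AC 4 ((1*3*4)*2)).
move/eqP; rewrite -subr_eq opprK -scalerDl => /eqP e.
have := tau_x4_neq0 q_neq0 qX_neq1; have := triangle_coef q_neq0 qX_neq1.
rewrite -phiE -tauE -triE => e' n0; rewrite e' -scalerA in e.
exact: scalerI n0 _ _ e.
Qed.

Lemma skein_coefs : c = kappa q /\ d = kappa q.
Proof.
have tau0 := tau_neq0.
have beta0 := beta_neq0.
have [C1 CU CH CN [Cp Cn _]] := cap_topE; have [M1 MU MH MN [Mp Mn _]] := merge_topE.
have Cn' : cap_top en = beta^-1 *: ecap by rewrite -Cn scalerA mulVf // scale1r.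
have Mn' : merge_top en = tau^-1 *: emer by rewrite -Mn scalerA mulVf // scale1r.
have : (beta - beta^-1) *: ecap = (c * (1 - delta) + d * phi) *: ecap.
  rewrite scalerBl -Cp -Cn' -linearB skein_cd linearD !linearZZ [cap_top (e1 - _)]linearB
    [cap_top (eH - _)]linearB C1 CU CH CN subr0.
  by rewrite -{1}[ecap]scale1r -scalerBl !scalerA -scalerDl.
have : (tau - tau^-1) *: emer = (c + d * (tri - phi)) *: emer.
  rewrite scalerBl -Mp -Mn' -linearB skein_cd linearD !linearZZ [merge_top (e1 - _)]linearB
    [merge_top (eH - _)]linearB M1 MU MH MN subr0 etriE.
  by rewrite -scalerBl !scalerA -scalerDl.
move=> /(scalar_inj emer_neq0) e2 /(scalar_inj ecap_neq0) e1.
rewrite phiE deltaE betaE in e1; rewrite phiE triE tauE in e2.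
exact: skein_coef q_neq0 qX_neq1 _ _ e1 e2.
Qed.

(** Converse of [qw_law]: an equation found by linear algebra becomes a law usable in rewriting. *)
Lemma qw_holds e n : wf e -> out (strands e) (lhs e) = n ->
  scal (lscal e) *: qw I (strands e) n (lhs e) =
    scal (rscal e) *: qw I (strands e) n (rhs e) ->
  holds I e.
Proof.
move=> w o E; split=> //; case/and3P: w => vl vr /eqP olr.
by rewrite -(arr_qw I vl o) -(arr_qw I vr (etrans (esym olr) o)) /ascale /= E.
Qed.

Lemma triangle : holds I (Eqn 2 [:: (1%N, Split); (0%N, Merge); (0%N, Merge)]
  [:: (0%N, Merge)] [::] [:: Atri]).
Proof.
apply: (@qw_holds _ 1) => //; rewrite /scal big_nil big_seq1 scale1r.
exact: etriE.
Qed.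

Lemma eHn_vec : eHn = vec (hn1 q) (hn2 q) (hn3 q) (hn4 q) (hn5 q).
Proof.
have tau0 := tau_neq0.
have [R1 RU RH RN [Rp _ RHp]] := rotate2E.
have [cE dE] := skein_coefs; have [-> -> -> -> ->] := neg_coef q_neq0 qX_neq1.
apply: (scalerI tau0); rewrite -RHp eHp_vec linear_vec R1 RU RH RN Rp en_vec cE dE.
rewrite e1_vec eU_vec eH_vec eN_vec !vecZ !vecD -tauE.
by congr (vec _ _ _ _ _); rewrite [RHS]mulrC divfK //; ring.
Qed.

Lemma eHH_vec : eHH = vec (hh1 q) (hh2 q) (hh3 q) (hh4 q) (hh5 q).
Proof.
have [cE dE] := skein_coefs.
have HU : H_bottom eU = phi *: eU.
  by rewrite H_bottom_qw //; exact: (lawr (a := Aphi) _ (U_H I)).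
have HN : H_bottom eN = tri *: eN.
  by rewrite H_bottom_qw //; exact: (lawr (a := Atri) _ (N_H triangle)).
have H1 : H_bottom e1 = eH by rewrite H_bottom_qw // cats0.
have HH : H_bottom eH = eHH by rewrite H_bottom_qw.
have Hp : H_bottom ep = eHp by rewrite H_bottom_qw.
have Hn : H_bottom en = eHn by rewrite H_bottom_qw.
have k0 := kappa_neq0 q_neq0 qX_neq1.
have : eHp - eHn = kappa q *: (eH - phi *: eU) + kappa q *: (eHH - tri *: eN).
  by rewrite -Hp -Hn -linearB skein_cd cE dE [LHS]linearD
    ![H_bottom (_ *: _)]linearZZ [H_bottom (e1 - _)]linearB
    [H_bottom (eH - _)]linearB HU HN H1 HH.
move=> e; apply: (scalerI k0).
have -> : kappa q *: eHH = eHp - eHn - kappa q *: (eH - phi *: eU) + kappa q *: (tri *: eN).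
  by rewrite e [_ + kappa q *: (eHH - _)]addrC addrK scalerBr subrK.
rewrite eHp_vec eHn_vec eH_vec eU_vec eN_vec !(vecZ, vecB, vecD).
have [<- <- <- <- <-] := square_coef q_neq0 qX_neq1; rewrite -phiE -triE.
by congr (vec _ _ _ _ _); ring.
Qed.
End SkeinCoefficients.
End FourPoint.

(** * Morphisms from two to three strands *)

(** The coordinates in the spanning family form a matrix with d + 1 rows and d columns; a nonzero
    row vector in its left kernel gives the dependency. *)
Lemma dim_le_dependent (K : fieldType) (V : lmodType K) d (f : nat -> V) :
  dim_le V d -> exists c : nat -> K,
    (exists2 i, (i < d.+1)%N & c i != 0) /\ \sum_(i < d.+1) c i *: f i = 0.
Proof.
case=> v span; have /boolp.choice[M fE] : forall i : 'I_d.+1, exists c : 'I_d -> K,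
  f i = \sum_(j < d) c j *: tnth v j by move=> i; apply: span.
pose A : 'M[K]_(d.+1, d) := \matrix_(i, j) M i j.
have kA : kermx A != 0 by rewrite kermx_eq0 /row_free neq_ltn ltnS rank_leq_col.
have /rowV0Pn[u /sub_kermxP uA u0] := kA.
exists (fun i => u 0 (inord i)); split.
  have /rV0Pn[i ui] := u0.
  by exists i => //; rewrite inord_val.
under eq_bigr => i _ do rewrite inord_val fE scaler_sumr.
rewrite exchange_big big1 // => j _.
under eq_bigr do rewrite scalerA.
rewrite -scaler_suml; have := congr1 (fun B : 'rV_d => B 0 j) uA.
rewrite !mxE => e; rewrite (_ : \sum_(i < _) _ = 0) ?scale0r // -[RHS]e.
by apply: eq_bigr => i _; rewrite mxE.
Qed.

Section MergeSums.
Variable K : fieldType.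
Implicit Types w a p t phi n k y tau : K.

(** Sums as they result from expanding a merged relation, regrouped over abstract letters rather
    than expressions in [q]. *)
Lemma merge_sum12 w a p t phi n k y0 y3 tau :
  w * (a + p * t) + phi * n + k * (y0 + tau * y3) =
  p * (t * w) + (y0 * k + n * phi + y3 * (tau * k) + a * w).
Proof. by ring. Qed.

Lemma merge_sum3 w a0 a2 a4 p t phi n k y0 y1 y3 tau :
  w * (a4 + p * t) + phi * a0 + t * a2 + n + k * (y0 + tau * y3) + tau * y1 =
  p * (t * w) + (a0 * phi + y0 * k + y1 * tau + a2 * t + (n + y3 * (tau * k)) + a4 * w).
Proof. by ring. Qed.

Lemma merge_sum5 w a p t phi k y0 y3 y4 tau :
  w * (a + p * t) + k * (y0 + tau * y3) + phi * y4 =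
  p * (t * w) + (y0 * k + y3 * (tau * k) + (a * w + y4 * phi)).
Proof. by ring. Qed.
End MergeSums.

Section FivePoint.
Variable I : tensor_ideal.
Hypothesis basis22 : is_basis [tuple qmor I (tid 2); qmor I tU; qmor I tH;
  qmor I tN; qmor I (tadd tsigp tsigm)].

Notation V := (QHom I 2 3).
Notation qP := (qw I 2 3 wP).

Definition cyc (s : seq word) k := qw I 2 3 (nth [::] s (k %% 5)).
Notation wQs := [:: wQ0; wQ1; wQ2; wQ3; wQ4].
Notation wRs := [:: wR0; wR1; wR2; wR3; wR4].
Notation wXs := [:: wX0; wX1; wX2; wX3; wX4].
Definition qQ := cyc wQs.
Definition qR := cyc wRs.
Definition qX := cyc wXs.

Definition rotate3 : {linear V -> V} :=
  GRing.Linear.clone _ _ _ _ (@whisk I 2 3 2 3 [:: (0%N, Cup)] 1 1 [:: (3%N, Cap)]) _.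
Definition merge_left3 : {linear V -> QHom I 2 2} :=
  GRing.Linear.clone _ _ _ _ (@whisk I 2 2 2 3 [::] 0 0 wmerge) _.
Definition bend : {linear V -> QHom I 3 2} :=
  GRing.Linear.clone _ _ _ _ (@whisk I 3 2 2 3 [::] 0 1 [:: (2%N, Cap)]) _.
Definition unbend : {linear QHom I 3 2 -> V} :=
  GRing.Linear.clone _ _ _ _ (@whisk I 2 3 3 2 [:: (2%N, Cup)] 0 1 [::]) _.

Definition fork w := valid 2 w && (out 2 w == 3).

Lemma rotate3_qw w : fork w -> rotate3 (qw I 2 3 w) = qw I 2 3 (rot 3 w).
Proof. by case/andP=> v o; apply: whisk_qw; rewrite v o. Qed.

Lemma merge_left3_qw w : fork w -> merge_left3 (qw I 2 3 w) = qw I 2 2 (w ++ wmerge).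
Proof. by case/andP=> v o; rewrite -{2}[w]shift0; apply: whisk_qw; rewrite v o. Qed.

Lemma bend_qw w : fork w -> bend (qw I 2 3 w) = qw I 3 2 (w ++ [:: (2%N, Cap)]).
Proof. by case/andP=> v o; rewrite -{2}[w]shift0; apply: whisk_qw; rewrite v o. Qed.

Lemma unbend_qw w : valid 3 w && (out 3 w == 2) ->
  unbend (qw I 3 2 w) = qw I 2 3 ((2%N, Cup) :: w).
Proof.
by case/andP=> v o; rewrite -{2}[w]shift0 -[shift 0 w]cats0; apply: whisk_qw; rewrite v o.
Qed.

Lemma cyc_per s k : cyc s (k + 5) = cyc s k.
Proof. by rewrite /cyc modnDr. Qed.

Lemma rotate3_cyc s : (forall k, (k < 5)%N ->
    fork (nth [::] s k) /\ holds I
      (Eqn 2 (rot 3 (nth [::] s k)) (nth [::] s (k.+1 %% 5)) [::] [::])) ->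
  forall k, rotate3 (cyc s k) = cyc s (k + 1).
Proof.
move=> H k; have [f /(law1 3) e] := H _ (ltn_pmod k (isT : 0 < 5)%N).
by rewrite /cyc rotate3_qw // e -[(k %% 5).+1]addn1 modnDml.
Qed.

Lemma rotate3_qQ k : rotate3 (qQ k) = qQ (k + 1).
Proof.
apply: rotate3_cyc => -[|[|[|[|[|//]]]]] _; split=> //.
- exact: rot_Q0. - exact: rot_Q1. - exact: rot_Q2. - exact: rot_Q3. - exact: rot_Q4.
Qed.

Lemma rotate3_qR k : rotate3 (qR k) = qR (k + 1).
Proof.
apply: rotate3_cyc => -[|[|[|[|[|//]]]]] _; split=> //.
- exact: rot_R0. - exact: rot_R1. - exact: rot_R2. - exact: rot_R3. - exact: rot_R4.
Qed.

Lemma rotate3_qX k : rotate3 (qX k) = qX (k + 1).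
Proof.
apply: rotate3_cyc => -[|[|[|[|[|//]]]]] _; split=> //.
- exact: rot_X0. - exact: rot_X1. - exact: rot_X2. - exact: rot_X3. - exact: rot_X4.
Qed.

Lemma rotate3_qP : rotate3 qP = qP.
Proof. by rewrite rotate3_qw //; exact: law1 (rot_P I). Qed.

Definition rel_term (a n y : nat -> Qq) k := a k *: qQ k + n k *: qR k + y k *: qX k.

Definition rel p (a n y : nat -> Qq) := p *: qP + (rel_term a n y 0 + rel_term a n y 1 +
  rel_term a n y 2 + rel_term a n y 3 + rel_term a n y 4) = 0.

Definition periodic (a : nat -> Qq) := forall k, a (k + 5)%N = a k.
Definition shiftc j (a : nat -> Qq) k := a (k + j)%N.

Lemma periodic_mul a : periodic a -> forall m k, a (k + m * 5)%N = a k.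
Proof.
by move=> pa; elim=> [|m IH] k; rewrite ?addn0 // mulSn addnCA addnC pa.
Qed.

Lemma sum5_combination (W : lmodType Qq) (b c : Qq) (u v w : nat -> W) :
  let s k := u k + b *: v k - c *: w k in
  s 0%N + s 1%N + s 2 + s 3 + s 4 = (u 0%N + u 1%N + u 2 + u 3 + u 4)
    + b *: (v 0%N + v 1%N + v 2 + v 3 + v 4) - c *: (w 0%N + w 1%N + w 2 + w 3 + w 4).
Proof.
rewrite /= !scalerDr !opprD.
by rewrite (AC (3*3*3*3*3) ((1*4*7*10*13)*(2*5*8*11*14)*(3*6*9*12*15))).
Qed.

Lemma linear_sum6 (W W' : lmodType Qq) (f : {linear W -> W'}) p v t0 t1 t2 t3 t4 :
  f (p *: v + (t0 + t1 + t2 + t3 + t4)) = p *: f v + (f t0 + f t1 + f t2 + f t3 + f t4).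
Proof. by rewrite !linearD linearZZ. Qed.

Lemma linear_rel_term (W : lmodType Qq) (f : {linear V -> W}) a n y k :
  f (rel_term a n y k) = a k *: f (qQ k) + n k *: f (qR k) + y k *: f (qX k).
Proof. by rewrite !linearD !linearZZ. Qed.

(** Rotation carries the coefficient of index k - 1 to index k; k + 4 stands for k - 1 modulo 5. *)
Lemma rel_rot p a n y : periodic a -> periodic n -> periodic y ->
  rel p a n y -> rel p (shiftc 4 a) (shiftc 4 n) (shiftc 4 y).
Proof.
move=> pa pn py r; rewrite /rel -[RHS](linear0 rotate3) -[in RHS]r.
rewrite linear_sum6 rotate3_qP; congr (_ + _).
have term k : rotate3 (rel_term a n y k) =
    rel_term (shiftc 4 a) (shiftc 4 n) (shiftc 4 y) (k + 1).
  by rewrite linear_rel_term /rel_term rotate3_qQ rotate3_qR rotate3_qX /shiftc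
    -addnA pa pn py.
have term5 : rel_term (shiftc 4 a) (shiftc 4 n) (shiftc 4 y) 5 =
    rel_term (shiftc 4 a) (shiftc 4 n) (shiftc 4 y) 0.
  rewrite /rel_term /shiftc /qQ /qR /qX -[5%N]add0n !cyc_per.
  by rewrite -addnA (addnC 5%N) addnA pa pn py.
by rewrite !term term5 (AC 5 (2*3*4*5*1)).
Qed.

Lemma rel_shift p a n y : periodic a -> periodic n -> periodic y -> rel p a n y ->
  forall r, rel p (shiftc r a) (shiftc r n) (shiftc r y).
Proof.
move=> pa pn py h r.
have ps a' j : periodic a' -> periodic (shiftc j a').
  by move=> pa' k; rewrite /shiftc addnAC pa'.
suff H j : rel p (shiftc (4 * j) a) (shiftc (4 * j) n) (shiftc (4 * j) y).
  (* A shift by [r] takes 4r rotations, since 16 is 1 modulo 5. *)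
  have E a' : periodic a' -> shiftc (4 * (4 * r)) a' = shiftc r a'.
    move=> pa'; apply/boolp.funext => k; rewrite /shiftc.
    by rewrite -[RHS](periodic_mul pa' (3 * r)) -addnA; congr (a' (_ + _)%N); lia.
  by move: (H (4 * r)%N); rewrite !E.
elim: j => [|j IH].
  have E a' : shiftc (4 * 0) a' = a'.
    by apply/boolp.funext => k; rewrite /shiftc muln0 addn0.
  by rewrite !E.
have E a' : shiftc (4 * j.+1) a' = shiftc 4 (shiftc (4 * j) a').
  by apply/boolp.funext => k; rewrite /shiftc mulnS addnA.
by rewrite !E; apply: rel_rot => //; apply: ps.
Qed.

Variables c d : Qq.
Hypothesis skein_cd : qw I 2 2 wp - qw I 2 2 wn =
  c *: (qw I 2 2 [::] - qw I 2 2 wU) + d *: (qw I 2 2 wH - qw I 2 2 wN).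

Notation vec := (@vec I).
Notation eHn := (vec (hn1 q) (hn2 q) (hn3 q) (hn4 q) (hn5 q)).
Notation eHH := (vec (hh1 q) (hh2 q) (hh3 q) (hh4 q) (hh5 q)).

Lemma vec0 : vec 0 0 0 0 0 = 0.
Proof. by rewrite /vec /comb !scale0r !addr0. Qed.

Lemma merge_left3_qP : merge_left3 qP = tri *: eHH.
Proof.
rewrite merge_left3_qw // -(eHH_vec basis22 skein_cd).
exact: (lawr (a := Atri) _ (merge_P (triangle basis22 skein_cd))).
Qed.

Lemma merge_left3_qQ : [/\ merge_left3 (qQ 0) = vec 0 0 phi 0 0,
  merge_left3 (qQ 1) = vec 0 0 0 tri 0, merge_left3 (qQ 2) = vec 0 0 tri 0 0,
  merge_left3 (qQ 3) = vec 0 0 0 phi 0 & merge_left3 (qQ 4) = eHH].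
Proof.
have t := triangle basis22 skein_cd.
split; rewrite /qQ /cyc /=; (rewrite merge_left3_qw; last by []).
- by rewrite (lawr (a := Aphi) _ (merge_Q0 I)) eH_vec vecZ !mulr0 mulr1.
- by rewrite (lawr (a := Atri) _ (merge_Q1 t)) eN_vec vecZ !mulr0 mulr1.
- by rewrite (lawr (a := Atri) _ (merge_Q2 t)) eH_vec vecZ !mulr0 mulr1.
- by rewrite (lawr (a := Aphi) _ (merge_Q3 I)) eN_vec vecZ !mulr0 mulr1.
- by rewrite -(eHH_vec basis22 skein_cd).
Qed.

Lemma merge_left3_qR : [/\ merge_left3 (qR 0) = vec 0 0 0 1 0,
  merge_left3 (qR 1) = vec phi 0 0 0 0, merge_left3 (qR 2) = vec 0 phi 0 0 0,
  merge_left3 (qR 3) = vec 0 0 1 0 0 & merge_left3 (qR 4) = vec 0 0 0 0 0].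
Proof.
split; rewrite /qR /cyc /=; (rewrite merge_left3_qw; last by []).
- by rewrite (law1 _ (merge_R0 I)) eN_vec.
- by rewrite (lawr (a := Aphi) _ (merge_R1 I)) e1_vec vecZ !mulr0 mulr1.
- by rewrite (lawr (a := Aphi) _ (merge_R2 I)) eU_vec vecZ !mulr0 mulr1.
- by rewrite -eH_vec.
- by rewrite (lawr (a := Azero) _ (merge_R4 I)) vec0 scale0r.
Qed.

Lemma merge_left3_qX : [/\ merge_left3 (qX 0) = eHn,
  merge_left3 (qX 1) = vec 0 0 tau 0 0, merge_left3 (qX 2) = vec 0 0 0 tau^-1 0,
  merge_left3 (qX 3) = tau *: eHn & merge_left3 (qX 4) = vec 0 0 0 0 phi].
Proof.
rewrite -(eHn_vec basis22 skein_cd).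
split; rewrite /qX /cyc /=; (rewrite merge_left3_qw; last by []).
- have := qw_law 2 (merge_X0 I); rewrite /scal big_seq1.
  exact: scalerI tau_neq0 _ _.
- by rewrite (lawr (a := Atau) _ (merge_X1 I)) eH_vec vecZ !mulr0 mulr1.
- apply: (scalerI tau_neq0); rewrite (lawl (a := Atau) _ (merge_X2 I)) eN_vec vecZ.
  by rewrite !mulr0 mulfV ?tau_neq0.
- exact: (lawr (a := Atau) _ (merge_X3 I)).
- by rewrite (lawr (a := Aphi) _ (merge_X4 I)) ep_vec vecZ !mulr0 mulr1.
Qed.

(** Merging the two left outputs lands in the space of known coordinates; the equations are those of
    [1], [U], [H] and [s+]. *)
Lemma rel_merge p a n y : rel p a n y -> [/\
    hh1 q * (a 4 + p * tri) + phi * n 1%N + hn1 q * (y 0%N + tau * y 3) = 0,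
    hh2 q * (a 4 + p * tri) + phi * n 2 + hn2 q * (y 0%N + tau * y 3) = 0,
    hh3 q * (a 4 + p * tri) + phi * a 0%N + tri * a 2 + n 3
      + hn3 q * (y 0%N + tau * y 3) + tau * y 1%N = 0
  & hh5 q * (a 4 + p * tri) + hn5 q * (y 0%N + tau * y 3) + phi * y 4 = 0].
Proof.
have [Q0 Q1 Q2 Q3 Q4] := merge_left3_qQ; have [R0 R1 R2 R3 R4] := merge_left3_qR.
have [X0 X1 X2 X3 X4] := merge_left3_qX.
move/(congr1 merge_left3); rewrite linear0 linear_sum6 !linear_rel_term merge_left3_qP.
rewrite Q0 Q1 Q2 Q3 Q4 R0 R1 R2 R3 R4 X0 X1 X2 X3 X4 !(vecZ, vecD).
case/(vec_free basis22 skein_cd); rewrite !(mulr0, mulr1, addr0, add0r) => h1 h2 h3 _ h5.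
by rewrite !merge_sum12 merge_sum3 merge_sum5.
Qed.

Lemma rel_kernel p a n y : periodic a -> periodic n -> periodic y -> rel p a n y ->
  forall r, [/\ a r = p, n r = nu q * p & y r = - chi q * p].
Proof.
move=> pa pn py h; apply: (merge_kernel q_neq0 qX_neq1 golden) => [r|r]; first by split.
have := rel_merge (rel_shift pa pn py h r); rewrite /shiftc -phiE -tauE -triE.
by rewrite ![(_ + r)%N]addnC addn0.
Qed.

Notation ws := (wP :: wQs ++ wRs ++ wXs).

(* The cup slides up along the right edge of the diagram to meet the cap. *)
Definition straighten (w : word) :=
  rcons [seq SwL (I := I) k | k <- iota 0 (size w)] (fw (zigzag_l I) (size w)).

Lemma straightenP w : w \in ws ->
  [/\ fork w, valid 2 ((2%N, Cup) :: w ++ [:: (2%N, Cap)]),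
    valid 3 (w ++ [:: (2%N, Cap)]) && (out 3 (w ++ [:: (2%N, Cap)]) == 2%N)
  & run 2 (straighten w) ((2%N, Cup) :: w ++ [:: (2%N, Cap)]) = Some (w, [::], [::])].
Proof.
(* A single boolean test decides all sixteen words by computation. *)
move=> ww; pose ok (w : word) := [&& fork w, valid 2 ((2%N, Cup) :: w ++ [:: (2%N, Cap)]),
  valid 3 (w ++ [:: (2%N, Cap)]) && (out 3 (w ++ [:: (2%N, Cap)]) == 2%N) &
  if run 2 (straighten w) ((2%N, Cup) :: w ++ [:: (2%N, Cap)]) is Some (w', [::], [::])
  then w' == w else false].
have /allP/(_ _ ww) : all ok ws by vm_compute.
rewrite /ok => /and4P[f v b r]; split=> //; move: r.
by case: (run _ _ _) => [[[w' [|? ?]] [|? ?]]|] // /eqP ->.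
Qed.

Lemma unbend_bend w : w \in ws -> unbend (bend (qw I 2 3 w)) = qw I 2 3 w.
Proof.
case/straightenP=> f v b r; rewrite bend_qw // unbend_qw //.
by apply: law1; apply: (derive (ms := straighten w)).
Qed.

Hypothesis dim32 : dim_le (QHom I 3 2) 15.

Lemma exists_rel : exists p a n y, [/\ periodic a, periodic n, periodic y, rel p a n y &
  [|| p != 0, [exists k : 'I_5, a k != 0], [exists k : 'I_5, n k != 0]
    | [exists k : 'I_5, y k != 0]]].
Proof.
have [m [[i i16 mi] mr]] :=
  dim_le_dependent (fun i => bend (qw I 2 3 (nth [::] ws i))) dim32.
have per j : periodic (fun k => m (j + k %% 5)%N) by move=> k; rewrite modnDr.
(* In [ws] the pentagon has position 0, and the three families start at 1, 6 and 11. *)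
exists (m 0%N), (fun k => m (1 + k %% 5)%N), (fun k => m (6 + k %% 5)%N),
  (fun k => m (11 + k %% 5)%N).
split=> //.
  have : unbend (\sum_(i < 16) m i *: bend (qw I 2 3 (nth [::] ws i))) = 0.
    by rewrite mr linear0.
  rewrite linear_sum; under eq_bigr => k _.
    rewrite linearZZ unbend_bend; last by apply: mem_nth.
    over.
  rewrite !big_ord_recr big_ord0 /= add0r /rel /rel_term /qQ /qR /qX /cyc /=.
  by rewrite (AC 16 (1*((2*7*12)*(3*8*13)*(4*9*14)*(5*10*15)*(6*11*16)))).
have [i0|ip] : (i = 0 \/ 0 < i)%N by lia.
  by move: mi; rewrite i0 => m0; apply/orP; left; exact: m0.
have E j k : (k < 5)%N -> i = (j + k)%N -> [exists k : 'I_5, m (j + k %% 5)%N != 0].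
  move=> lt_k5 ik; apply/existsP; exists (Ordinal lt_k5).
  by rewrite /= (modn_small lt_k5) -ik; exact: mi.
apply/orP; right; have [i6|i6] : (i < 6 \/ 6 <= i)%N by lia.
  by apply/orP; left; apply: (E 1%N (i - 1)%N); lia.
apply/orP; right; have [i11|i11] : (i < 11 \/ 11 <= i)%N by lia.
  by apply/orP; left; apply: (E 6 (i - 6)%N); lia.
by apply/orP; right; apply: (E 11 (i - 11)%N); lia.
Qed.

Lemma pentagon : qP = - (qQ 0 + qQ 1 + qQ 2 + qQ 3 + qQ 4)
  - nu q *: (qR 0 + qR 1 + qR 2 + qR 3 + qR 4)
  + chi q *: (qX 0 + qX 1 + qX 2 + qX 3 + qX 4).
Proof.
have [p [a [n [y [pa pn py h nz]]]]] := exists_rel.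
have ker := rel_kernel pa pn py h.
(* All coefficients are multiples of [p], and the dependency is nontrivial. *)
have p0 : p != 0.
  apply/eqP => p0; move: nz; rewrite p0 eqxx /=.
  case/or3P => /existsP[k]; have [aE nE yE] := ker k.
  - by rewrite aE p0 eqxx.
  - by rewrite nE p0 mulr0 eqxx.
  - by rewrite yE p0 mulr0 eqxx.
have t k : rel_term a n y k = p *: (qQ k + nu q *: qR k - chi q *: qX k).
  have [aE nE yE] := ker k.
  by rewrite /rel_term aE nE yE !scalerDr scalerN !scalerA ![p * _]mulrC mulNr scaleNr.
move/eqP: h; rewrite /rel !t -!scalerDr scaler_eq0 (negPf p0) /= sum5_combination.
by rewrite addr_eq0 => /eqP ->; rewrite !opprD opprK.
Qed.
End FivePoint.

(** * Passage from the terms of the theorem to words *)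

Section Statement.
Variable I : tensor_ideal.

(** [flat] unfolds [tsplit] into a cup and a merge; [ks] lists the layers at which it is folded
    back, in order. *)
Lemma qmor_fold (f : term 2 3) ks w : monomial f ->
  run 2 [seq fw (split_l I) k | k <- ks] (flat f) = Some (w, [::], [::]) ->
  qmor I f = qw I 2 3 w.
Proof. exact: qmor_qw. Qed.

Lemma sum_tQs : \sum_(j < 5) qmor I (tnth tQs j) =
  qQ I 0 + qQ I 1 + qQ I 2 + qQ I 3 + qQ I 4.
Proof.
rewrite !big_ord_recr big_ord0 /= add0r !(tnth_nth tzero) /=.
rewrite (@qmor_fold _ [:: 0; 1]%N wQ2) // (@qmor_fold _ [:: 1; 2]%N wQ3) //.
rewrite (@qmor_fold _ [:: 1; 2]%N wQ1) // (@qmor_fold _ [:: 0; 2]%N wQ4) //.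
rewrite (@qmor_fold _ [:: 0; 2]%N wQ0) //.
by rewrite (AC 5 (5*3*1*2*4)).
Qed.

Lemma sum_tNs : \sum_(j < 5) qmor I (tnth tNs j) =
  qR I 0 + qR I 1 + qR I 2 + qR I 3 + qR I 4.
Proof.
rewrite !big_ord_recr big_ord0 /= add0r !(tnth_nth tzero) /=.
rewrite (@qmor_fold _ [:: 2]%N wR2) // (@qmor_fold _ [:: 0]%N wR3) //.
rewrite (@qmor_fold _ [:: 0]%N wR1) // (@qmor_fold _ [::] wR4) //.
rewrite (@qmor_fold _ [::] wR0) //.
by rewrite (AC 5 (5*3*1*2*4)).
Qed.

Lemma sum_tXs : \sum_(j < 5) qmor I (tnth tXs j) =
  qX I 0 + qX I 1 + qX I 2 + qX I 3 + qX I 4.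
Proof.
rewrite !big_ord_recr big_ord0 /= add0r !(tnth_nth tzero) /=.
rewrite (@qmor_fold _ [::] wX2) // (@qmor_fold _ [:: 0]%N wX3) //.
rewrite (@qmor_fold _ [:: 0]%N wX1) // (@qmor_fold _ [:: 1]%N wX4) //.
rewrite (@qmor_fold _ [:: 1]%N wX0) //.
by rewrite (AC 5 (5*3*1*2*4)).
Qed.
End Statement.

Theorem proposition4p4 (I : tensor_ideal)
    (delta_neq1 : delta != q ^+ 4 + q ^- 4)
    (delta_neq2 : delta != - q ^+ 16 - q ^- 16)
    (basis22 : is_basis [tuple qmor I (tid 2); qmor I tU; qmor I tH; qmor I tN;
                               qmor I (tadd tsigp tsigm)])
    (dim32 : dim_le (QHom I 3 2) 15)
    (indepNX : lin_indep [tuple of [seq qmor I f | f <- tNs ++ tXs]]) :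
  qmor I tP =
    - (\sum_(j < 5) qmor I (tnth tQs j))
    - (qint 7 / qint 4 ^+ 2) *: (\sum_(j < 5) qmor I (tnth tNs j))
    + (qint 3 ^+ 2 / qint 4 ^+ 2) *: (\sum_(j < 5) qmor I (tnth tXs j)).
Proof.
have [c [d skein_cd]] := skein basis22.
rewrite sum_tQs sum_tNs sum_tXs (@qmor_fold I _ [:: 0; 2; 3]%N wP) //.
rewrite (pentagon basis22 skein_cd dim32).
by rewrite -(nuE q_neq0 qX_neq1) -(chiE q_neq0 qX_neq1).
Qed.
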